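(* For $n\ge1$ let $f_n(t)=\sum_M t^{|M_{\text{not min}}|}$, summing over all Matryoshkas $M$ of a convex $(n+2)$-gon (so $f_1=1$, $f_2=1+2t$, $f_3=1+10t+10t^2$), and let $g_n(t)=[(1+t)f_n(t)-1]/t$. Then $(f_n(t))_{n\ge1}$ is the unique sequence of polynomials such that the power series in $x$ with coefficients in $\mathbb R[t]$ $$x-f_1(t)x^2-f_2(t)x^3-f_3(t)x^4-\cdots\quad\text{and}\quad x+g_1(t)x^2+g_2(t)x^3+g_3(t)x^4+\cdots$$ are compositional inverses of each other. Equivalently, $A_t(x)=x-\sum_{n\ge1}f_n(t)x^{n+1}$ satisfies $$A_t\!\left(\frac{(2t+1)x-(2t+2)x^2}{t(1-x)}-\Big(1+\frac1t\Big)A_t(x)\right)=x.$$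
   Context: A subpolygon of a convex polygon $P$ is the convex hull of at least three vertices of $P$; a subdivision of a subpolygon $X$ is a set of subpolygons with union $X$ and pairwise disjoint interiors. A Matryoshka of $P$ is a set $M$ of subpolygons with $P\in M$ such that for every non-minimal $X\in M$ the inclusion-maximal elements of $\{Y\in M:Y\subsetneq X\}$ form a subdivision of $X$. $M_{\text{not min}}$ is the set of polygons of $M$ that are not inclusion-minimal in $M$. (In the paper, $f_n(t)$ is the $f$-polynomial of the $(n-1)$-dimensional cosmohedron, counting nonempty faces by codimension; the face of codimension $|M_{\text{not min}}|$ corresponds to $M$.) *)

(* Defs.v *)
From HB Require Import structures.
From mathcomp Require Import all_boot all_order all_algebra finmap.
From mathcomp Require Import all_classical all_reals all_analysis.
Set Implicit Arguments.
Unset Strict Implicit.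
Unset Printing Implicit Defensive.
Import Order.TTheory GRing.Theory Num.Theory.
Import numFieldNormedType.Exports.

Local Open Scope classical_set_scope.
Local Open Scope ring_scope.

Section Matryoshkas.
Variable R : realType.
Notation plane := 'rV[R]_2.

Definition convex_hull (A : set plane) : set plane :=
  smallest (@convex_set R plane) A.

(* Being the set of vertices of a convex m-gon: no point lies in the convex
   hull of the others.  The labelling by 'I_m need not follow the cyclic order
   of the vertices.  For m >= 3 this forces distinct, non-collinear points. *)
Definition convex_position m (p : 'I_m -> plane) : Prop :=
  forall i, ~ convex_hull [set p j | j in [set j | j != i]] (p i).

Definition polygon m (p : 'I_m -> plane) : set plane := convex_hull (range p).

Definition subpolygon m (p : 'I_m -> plane) (X : set plane) : Prop :=
  exists2 S : {set 'I_m}, (3 <= #|S|)%N & X = convex_hull (p @` [set` S]).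

Definition subdivision m (p : 'I_m -> plane) (X : set plane)
    (D : set (set plane)) : Prop :=
  [/\ D `<=` subpolygon p, \bigcup_(Y in D) Y = X
    & trivIset D (fun Y => Y°)].

Definition minimal_in (M : set (set plane)) (X : set plane) : Prop :=
  M X /\ forall Y, M Y -> ~ (Y `<` X).

Definition maximal_in (M : set (set plane)) (X : set plane) : Prop :=
  M X /\ forall Y, M Y -> ~ (X `<` Y).

Definition not_min (M : set (set plane)) : set (set plane) :=
  [set X | M X /\ ~ minimal_in M X].

Definition matryoshka m (p : 'I_m -> plane) (M : set (set plane)) : Prop :=
  [/\ M `<=` subpolygon p, M (polygon p)
    & forall X, not_min M X ->
        subdivision p X (maximal_in [set Y | M Y /\ Y `<` X])].

(* A polygon has finitely many Matryoshkas, each of them finite, so neither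
   the default value of a sum with infinite support nor that of the cardinal
   of an infinite set is ever met. *)
Definition matryoshka_poly m (p : 'I_m -> plane) : {poly R} :=
  \sum_(M \in matryoshka p) ('X^#|` fset_set (not_min M)| : {poly R}).

End Matryoshkas.

(* Formal power series, given by their sequence of coefficients. *)
Section PowerSeries.
Variable K : comNzRingType.
Implicit Types a b : nat -> K.

Definition fps_one : nat -> K := fun n => (n == 0%N)%:R.
Definition fps_X : nat -> K := fun n => (n == 1%N)%:R.
Definition fps_add a b : nat -> K := fun n => a n + b n.
Definition fps_opp a : nat -> K := fun n => - a n.
Definition fps_scale (c : K) a : nat -> K := fun n => c * a n.
Definition fps_mul a b : nat -> K :=
  fun n => \sum_(i < n.+1) a i * b (n - i)%N.
Definition fps_exp a k : nat -> K := iter k (fps_mul a) fps_one.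

(* [fps_comp a b] is a(b(x)), for b 0 = 0: the powers b^k with k > n do not
   contribute to the coefficient of x^n. *)
Definition fps_comp a b : nat -> K :=
  fun n => \sum_(k < n.+1) a k * fps_exp b k n.

Definition comp_inverse a b : Prop :=
  [/\ a 0%N = 0, b 0%N = 0,
      fps_comp a b =1 fps_X & fps_comp b a =1 fps_X].

Definition fps_geom : nat -> K := fun=> 1.

(* fps_geom is 1 / (1 - x) *)
Lemma fps_geomE :
  fps_mul (fps_add fps_one (fps_opp fps_X)) fps_geom =1 fps_one.
Proof.
rewrite /fps_mul /fps_add /fps_opp /fps_one /fps_X /fps_geom => -[|n].
  by rewrite big_ord1 /= subr0 mulr1.
rewrite 2!big_ord_recl big1 /= => [|i _]; last by rewrite subrr mul0r.
by rewrite subr0 sub0r !mulr1 addr0 subrr.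
Qed.

End PowerSeries.

(* R(t): 1/t occurs in the statement, so the power series in x are taken with
   coefficients in the fraction field of R[t]. *)
Section Series.
Variable R : realType.
Notation ratfun := {fraction {poly R}}.
Implicit Type h : nat -> {poly R}.

Definition to_ratfun (q : {poly R}) : ratfun := FracField.tofrac q.
Definition ratfun_X : ratfun := to_ratfun 'X.

(* The series below only depend on the values h n with n >= 1. *)
Definition gcoef h n : ratfun :=
  ((1 + ratfun_X) * to_ratfun (h n) - 1) / ratfun_X.

Definition Aseries h : nat -> ratfun :=
  fun k => if k is n.+2 then - to_ratfun (h n.+1) else fps_X ratfun k.

Definition Bseries h : nat -> ratfun :=
  fun k => if k is n.+2 then gcoef h n.+1 else fps_X ratfun k.

Definition inverse_pair h : Prop := comp_inverse (Aseries h) (Bseries h).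

(* ((2t+1)x - (2t+2)x^2) / (t(1-x)) - (1 + 1/t) A(x) *)
Definition inner_series h : nat -> ratfun :=
  let x := fps_X ratfun in
  fps_add
    (fps_scale ratfun_X^-1
      (fps_mul (fps_add (fps_scale (2 * ratfun_X + 1) x)
                        (fps_opp (fps_scale (2 * ratfun_X + 2) (fps_exp x 2))))
               (fps_geom ratfun)))
    (fps_opp (fps_scale (1 + 1 / ratfun_X) (Aseries h))).

Lemma inner_series0 h : inner_series h 0%N = 0.
Proof.
rewrite /inner_series /fps_add /fps_opp /fps_scale /fps_mul /fps_exp /fps_mul.
rewrite !big_ord1 /Aseries /fps_X /fps_geom /=.
by rewrite !(mulr0, mul0r, oppr0, addr0, big_ord1).
Qed.

Definition functional_equation h : Prop :=
  fps_comp (Aseries h) (inner_series h) =1 fps_X ratfun.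

End Series.

(* Main.v *)
Require Import Defs.
From mathcomp Require Import all_boot all_order all_algebra fingroup perm finmap.
From mathcomp Require Import all_classical all_reals all_analysis.
From mathcomp Require Import ring lra zify.
Import Order.TTheory GRing.Theory Num.Theory.
Import numFieldNormedType.Exports.
Local Open Scope ring_scope.
Set Implicit Arguments.
Unset Strict Implicit.
Unset Printing Implicit Defensive.

(* Order the vertices cyclically.  Removing P from a Matryoshka splits it
   into Matryoshkas of the pieces of a nontrivial subdivision of P, whence
   f_n = 1 + t (s_n - f_n), where s_n is the sum over all subdivisions of a
   convex (n+2)-gon of the product of the f_k of their pieces; that is,
   s_n = g_n.  On the other hand a subdivision is obtained from the piece
   containing a fixed root edge by gluing a subdivided polygon, or nothing, to
   each of its other edges, so that B = x + sum_n g_n x^(n+1) satisfies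
   B = x + sum_n f_n B^(n+1), i.e. A(B(x)) = x. *)

(** Pieces of a subdivision are only known to cover and to have disjoint interiors, so the gluing
    decomposition has to be won from plane geometry. In a counterclockwise labelling a piece is
    recorded by its set of labels. No other piece crosses a chord of the root piece, because
    crossing segments force interiors to meet. The root piece is then explored one edge at a time:
    once it is known up to a vertex a, its next vertex b cuts off the polygon behind the chord ab,
    and each such cut contributes one factor of B. A region with two vertices has exactly one
    subdivision, the empty one, which accounts for the term x of B.

    A second obstacle is that f_n belongs to one chosen polygon while the pieces are others. Strong
    induction on the number of vertices shows that the Matryoshka sum depends on that number only.
    For this the recursion for B is solved with arbitrary weights, and the still unknown top weight
    cancels in s_n - f_n.

    Uniqueness has the same source: A(B(x)) = x gives g_n = f_n + (terms in lower coefficients), and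
    with t g_n = (1+t) f_n - 1 this determines f_n. *)

Lemma eq_from_multiple (K : comNzRingType) (k x y u v : K) :
  u = v -> x - y = k * (u - v) -> x = y.
Proof. by move=> -> /eqP; rewrite subrr mulr0 subr_eq0 => /eqP. Qed.

#[local] Arguments fps_exp [K] a k _ : simpl never.

(** * Formal power series: composition, compositional inverses, recursively defined series *)

Section FormalSeries.
Variable K : comNzRingType.
Implicit Types (a b c : nat -> K) (p q : {poly K}).

(** [q ^+ k] has no term of degree below [k], so the sums up to [size p] and up to [n] both agree
    with the sum up to a common larger bound. *)
Lemma coef_comp_poly0 p q n : q`_0 = 0 ->
  (p \Po q)`_n = \sum_(k < n.+1) p`_k * (q ^+ k)`_n.
Proof.
move=> q0; have qk0 k i : (i < k)%N -> (q ^+ k)`_i = 0.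
  elim: k i => // k IH i ik; rewrite exprS coefM big1 // => -[j /= ji] _.
  by case: j ji => [|j] ji; rewrite ?q0 ?mul0r // IH ?mulr0 //; lia.
rewrite comp_polyE coef_sum.
under eq_bigr => i _ do rewrite coefZ.
pose F k := p`_k * (q ^+ k)`_n.
rewrite -(big_mkord xpredT F) -[RHS](big_mkord xpredT F).
have H m : (maxn (size p) n.+1 <= m)%N ->
    \sum_(0 <= k < size p) F k = \sum_(0 <= k < m) F k /\
    \sum_(0 <= k < n.+1) F k = \sum_(0 <= k < m) F k.
  rewrite geq_max => /andP[pm nm]; split.
    rewrite [RHS](big_cat_nat (leq0n _) pm)//= [X in _ = _ + X]big_nat_cond.
    rewrite [X in _ = _ + X]big1 ?addr0// /F => k /andP[/andP[sk _] _].
    by rewrite nth_default ?mul0r.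
  rewrite [RHS](big_cat_nat (leq0n _) nm)//= [X in _ = _ + X]big_nat_cond.
  rewrite [X in _ = _ + X]big1 ?addr0// /F => k /andP[/andP[sk _] _].
  by rewrite qk0 ?mulr0.
by have [-> ->] := H _ (leqnn _).
Qed.

Lemma eq_coef_exp p q n : (forall i, (i <= n)%N -> p`_i = q`_i) ->
  forall k, (p ^+ k)`_n = (q ^+ k)`_n.
Proof.
move=> pq k; elim: k n pq => [|k IH] n pq //; rewrite !exprS !coefM.
apply: eq_bigr => -[i /= iN] _; rewrite pq; last by lia.
congr (_ * _); apply: IH => j jn; apply: pq; exact: leq_trans jn (leq_subr _ _).
Qed.

Lemma fps_expE N a k n : (n < N)%N ->
  fps_exp a k n = ((\poly_(i < N) a i) ^+ k)`_n.
Proof.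
elim: k n => [|k IH] n nN; first by rewrite expr0 coef1.
rewrite exprS coefM; apply: eq_bigr => -[i /= iN] _.
rewrite coef_poly ifT; last by lia.
by congr (_ * _); apply: IH; lia.
Qed.

(** Any truncation beyond degree [n] computes coefficient [n], so associativity of composition can
    be borrowed from polynomials. *)
Lemma fps_compE N a b n : b 0%N = 0 -> (n < N)%N ->
  fps_comp a b n = ((\poly_(i < N) a i) \Po \poly_(i < N) b i)`_n.
Proof.
move=> b0 nN; rewrite coef_comp_poly0; last by rewrite coef_poly b0 if_same.
apply: eq_bigr => -[k /= kn] _.
by rewrite coef_poly ifT ?(fps_expE _ _ nN) //; lia.
Qed.

Lemma eq_fps_exp a b n : (forall i, (i <= n)%N -> a i = b i) ->
  forall k, fps_exp a k n = fps_exp b k n.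
Proof.
move=> ab k; rewrite !(@fps_expE n.+1) //; apply: eq_coef_exp => i iN.
by rewrite !coef_poly ab.
Qed.

Lemma fps_expS a k n :
  fps_exp a k.+1 n = \sum_(i < n.+1) a i * fps_exp a k (n - i)%N.
Proof. by []. Qed.

Lemma fps_exp0 a k n : a 0%N = 0 -> (n < k)%N -> fps_exp a k n = 0.
Proof.
move=> a0; elim: k n => // k IH n nk; rewrite fps_expS.
apply: big1 => -[[|i] ik] _ //=; first by rewrite a0 mul0r.
by rewrite IH ?mulr0 //=; lia.
Qed.

Lemma fps_exp1 a : fps_exp a 1 =1 a.
Proof.
move=> n; rewrite (@fps_expE n.+1) // expr1 coef_poly ltnSn //.
Qed.

(** In a product of at least two series without constant term, the other factors use up at least one
    degree, so coefficient [n] of a factor never reaches degree [n]. This makes the recursions below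
    solvable degree by degree. *)
Lemma eq_fps_exp_ge2 a b n : a 0%N = 0 -> b 0%N = 0 ->
  (forall i, (i < n)%N -> a i = b i) ->
  forall k, fps_exp a k.+2 n = fps_exp b k.+2 n.
Proof.
move=> a0 b0 ab k; rewrite !(fps_expS _ k.+1); apply: eq_bigr => -[i /= ik] _.
have [->|i0] := eqVneq i 0%N; first by rewrite a0 b0 !mul0r.
have [->|iN] := eqVneq i n.
  by rewrite subnn !fps_exp0 ?mulr0.
rewrite ab; last by lia.
congr (_ * _); apply: (@eq_fps_exp _ _ _ _ k.+1) => j jn; apply: ab; lia.
Qed.

Lemma fps_compA a b c : b 0%N = 0 -> c 0%N = 0 ->
  fps_comp a (fps_comp b c) =1 fps_comp (fps_comp a b) c.
Proof.
move=> b0 c0 n.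
have bc0 : fps_comp b c 0%N = 0 by rewrite /fps_comp big_ord1 b0 mul0r.
pose T u := \poly_(i < n.+1) (u i : K).
have T0 u : u 0%N = 0 -> (T u)`_0 = 0 by move=> u0; rewrite coef_poly /= u0.
have eqT u p i : (forall j, (j < n.+1)%N -> u j = p`_j) -> (i <= n)%N -> (T u)`_i = p`_i.
  by move=> up iN; rewrite coef_poly ifT ?up.
rewrite (fps_compE _ bc0 (ltnSn n)) (fps_compE _ c0 (ltnSn n)) -/(T _).
rewrite -/(T a) -/(T c) -/(T (fps_comp a b)) !coef_comp_poly0 ?T0//.
have -> : \sum_(k < n.+1) (T (fps_comp a b))`_k * ((T c) ^+ k)`_n =
          ((T a \Po T b) \Po T c)`_n.
  rewrite coef_comp_poly0 ?T0//; apply: eq_bigr => -[k /= kn] _.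
  by rewrite (@eqT _ (T a \Po T b)) // => j jn; rewrite (@fps_compE n.+1).
rewrite -comp_polyA coef_comp_poly0; last first.
  by rewrite coef_comp_poly0 ?T0// big_ord1 T0 ?mul0r.
apply: eq_bigr => -[k /= kn] _; congr (_ * _).
apply: eq_coef_exp => i iN; apply: eqT => // j jn.
by rewrite (@fps_compE n.+1).
Qed.

(** In each degree the composite is the coefficient of the inner series plus terms from its powers
    of exponent at least 2, which involve lower coefficients only. *)
Lemma fps_comp_inj a b c : a 0%N = 0 -> a 1%N = 1 -> b 0%N = 0 -> c 0%N = 0 ->
  fps_comp a b =1 fps_comp a c -> b =1 c.
Proof.
move=> a0 a1 b0 c0 abc; elim/ltn_ind => -[|n] IH; first by rewrite b0 c0.
have := abc n.+1; rewrite /fps_comp !big_ord_recl /= a0 a1 !mul0r !mul1r !add0r.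
rewrite /bump /= -/(fps_exp b 1) -/(fps_exp c 1) !fps_exp1.
rewrite [X in _ + X = _](_ : _ = \sum_(i < n) a i.+2 * fps_exp c i.+2 n.+1).
  by move=> /addIr.
by apply: eq_bigr => i _; congr (_ * _); apply: eq_fps_exp_ge2.
Qed.

Lemma fps_comp_X a : fps_comp a (fps_X K) =1 a.
Proof.
move=> n; rewrite (@fps_compE n.+1) //.
rewrite coef_comp_poly0; last by rewrite coef_poly.
rewrite big_ord_recr /= big1 ?add0r => [|[k /= kn] _].
  rewrite coef_poly ltnSn; case: n => [|n]; first by rewrite expr0 coef1 mulr1.
  rewrite (_ : \poly_(i < n.+2) _ = 'X) ?coefXn ?eqxx ?mulr1//.
  by apply/polyP => -[|[|i]]; rewrite coef_poly coefX //= if_same.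
case: n kn => // n kn.
rewrite (_ : \poly_(i < n.+2) fps_X K i = 'X) ?coefXn.
  by rewrite gtn_eqF ?mulr0.
by apply/polyP => -[|[|i]]; rewrite coef_poly coefX //= if_same.
Qed.

Lemma fps_X_comp a : a 0%N = 0 -> fps_comp (fps_X K) a =1 a.
Proof.
move=> a0 [|n]; first by rewrite /fps_comp big_ord1 mul0r.
rewrite /fps_comp big_ord_recl mul0r add0r big_ord_recl /= mul1r /bump /=.
rewrite -/(fps_exp a 1) fps_exp1 big1 ?addr0// => i _.
by rewrite mul0r.
Qed.

Lemma fps_exp_diag a n : a 0%N = 0 -> a 1%N = 1 -> fps_exp a n n = 1.
Proof.
move=> a0 a1; elim: n => // n IH.
rewrite fps_expS big_ord_recl a0 mul0r add0r big_ord_recl /= a1 mul1r.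
rewrite /bump /= subSS subn0 IH big1 ?addr0// => i _.
by rewrite fps_exp0 ?mulr0//=; have := ltn_ord i; lia.
Qed.

Section LowDegree.
Variable a : nat -> K.
Hypotheses (a0 : a 0%N = 0) (a1 : a 1%N = 1).

Lemma fps_exp_2_3 : fps_exp a 2 3 = 2 * a 2%N.
Proof.
rewrite fps_expS !big_ord_recl big_ord0 /= /bump /= !fps_exp1 /= a0 a1.
by move: (a 2%N) (a 3%N) => x y; ring.
Qed.

Lemma fps_exp_2_4 : fps_exp a 2 4 = 2 * a 3%N + a 2%N ^+ 2.
Proof.
rewrite fps_expS !big_ord_recl big_ord0 /= /bump /= !fps_exp1 /= a0 a1.
by move: (a 2%N) (a 3%N) (a 4%N) => x y z; ring.
Qed.

Lemma fps_exp_3_4 : fps_exp a 3 4 = 3 * a 2%N.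
Proof.
rewrite fps_expS !big_ord_recl big_ord0 /= /bump /=.
rewrite [fps_exp a 2 (4 - 1)]fps_exp_2_3 [fps_exp a 2 (4 - 2)]fps_exp_diag //.
rewrite [fps_exp a 2 (4 - 3)]fps_exp0 // [fps_exp a 2 (4 - 4)]fps_exp0 // a0 a1.
by move: (a 2%N) (a 3%N) (a 4%N) (fps_exp a 2 _) => x y z w; ring.
Qed.

End LowDegree.

(* If a(b(x)) = x then a(b(a(x))) = a(x), and a(x) = x + ... is left
   cancellable. *)
Lemma comp_inverse_sym a b : a 0%N = 0 -> a 1%N = 1 -> b 0%N = 0 ->
  fps_comp a b =1 fps_X K -> comp_inverse a b.
Proof.
move=> a0 a1 b0 ab; split=> //.
have ba0 : fps_comp b a 0%N = 0 by rewrite /fps_comp big_ord1 b0 mul0r.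
apply: (fps_comp_inj a0 a1) => // n; rewrite fps_compA // fps_comp_X.
transitivity (fps_comp (fps_X K) a n); last exact: fps_X_comp.
by rewrite /fps_comp; apply: eq_bigr => k _; rewrite -/(fps_comp a b _) ab.
Qed.

(** When the n-th output of [P] depends only on inputs below n, coefficient n of the iterates no
    longer changes after n+1 steps. *)
Definition fps_fix (P : (nat -> K) -> nat -> K) : nat -> K :=
  fun n => iter n.+1 P (fun=> 0) n.

Lemma fps_fixE (P : (nat -> K) -> nat -> K) :
  (forall a b n, (forall i, (i < n)%N -> a i = b i) -> P a n = P b n) ->
  forall n, fps_fix P n = P (fps_fix P) n.
Proof.
move=> causal; pose u k := iter k P (fun=> 0).
have stable k l n : (n < k)%N -> (n < l)%N -> u k n = u l n.
  elim: k l n => // k IH [|l] n // nk nl; apply: causal => i iN.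
  by apply: IH; exact: leq_trans iN _.
by move=> n; apply: causal => i iN; apply: (stable n i.+1).
Qed.

(** Solves b = x + sum of w_(k+3) b^(k+2): weights are indexed by the number of vertices of a piece,
    and a piece with k+3 vertices has k+2 edges besides its root edge. The weights stay arbitrary
    because truncated ones are needed later. *)
Lemma exists_inverse_coefs (w : nat -> K) : exists b : nat -> K,
  [/\ b 0%N = 0, b 1%N = 1 & forall n, b n.+2 =
    \sum_(k < n.+1) w k.+3 * fps_exp b k.+2 n.+2].
Proof.
(* [z] clears the constant term, because [P] has to be causal on all sequences, including those that
   do not vanish at 0. *)
pose z (b : nat -> K) n := if n is 0 then 0 else b n.
pose P b n := if n is n'.+2 then
    \sum_(k < n'.+1) w k.+3 * fps_exp (z b) k.+2 n else (fps_X K n).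
have PE : forall n, fps_fix P n = P (fps_fix P) n.
  apply: fps_fixE => a b [|[|n]] // ab; apply: eq_bigr => k _.
  by congr (_ * _); apply: eq_fps_exp_ge2 => // -[|i] // iN; apply: ab.
exists (fps_fix P); split; rewrite ?PE // => n; rewrite PE.
apply: eq_bigr => k _; congr (_ * _); apply: eq_fps_exp => -[|i] // _.
Qed.

End FormalSeries.

(** * The inverse pair and the functional equation over R(t) *)

Section FieldIdentities.
Variable (F : fieldType) (t : F).

Lemma inner_coef1 : t != 0 -> t^-1 * (2 * t + 1) - (1 + 1 / t) = 1.
Proof. by move=> t0; field. Qed.

Lemma inner_coef2 u : t != 0 ->
  t^-1 * (2 * t + 1 - (2 * t + 2)) - (1 + 1 / t) * - u = ((1 + t) * u - 1) / t.
Proof. by move=> t0; field. Qed.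

(** In the uniqueness proof [u] and [v] are two candidates for f_n, and [r] collects the terms in
    lower coefficients, so that [u + r] is g_n; the multiples t u cancel and leave u = 1 + t r. *)
Lemma linear_unique u v r : t * (u + r) = (1 + t) * u - 1 ->
  t * (v + r) = (1 + t) * v - 1 -> u = v.
Proof.
have E x : t * (x + r) = (1 + t) * x - 1 -> x = 1 + t * r.
  move=> e; apply: (eq_from_multiple (k := -1) e); ring.
by move=> /E -> /E ->.
Qed.

End FieldIdentities.

Section CosmohedronSeries.
Variable R : realType.
Implicit Types (h f : nat -> {poly R}).
Local Notation ratfun := {fraction {poly R}}.

Lemma ratfun_X_neq0 : ratfun_X R != 0.
Proof. by rewrite /ratfun_X /to_ratfun tofrac_eq0 polyX_eq0. Qed.

Lemma mul_gcoef h n :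
  ratfun_X R * gcoef h n = (1 + ratfun_X R) * to_ratfun (h n) - 1.
Proof. by rewrite /gcoef mulrC divfK // ratfun_X_neq0. Qed.

Lemma Aseries_compE h (c : nat -> ratfun) : c 0%N = 0 -> c 1%N = 1 ->
  fps_comp (Aseries h) c =1 fps_X ratfun <->
  forall n, c n.+2 =
    \sum_(k < n.+1) to_ratfun (h k.+1) * fps_exp c k.+2 n.+2.
Proof.
move=> c0 c1; have E n : fps_comp (Aseries h) c n.+2 =
    c n.+2 - \sum_(k < n.+1) to_ratfun (h k.+1) * fps_exp c k.+2 n.+2.
  rewrite /fps_comp big_ord_recl big_ord_recl /= /fps_X /= mul0r add0r mul1r.
  rewrite /bump /= fps_exp1 -sumrN; congr (_ + _); apply: eq_bigr => k _.
  by rewrite mulNr.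
split=> H => [n|[|[|n]]].
- by have := H n.+2; rewrite E /fps_X /= => /eqP; rewrite subr_eq0 => /eqP.
- by rewrite /fps_comp big_ord1 mul0r.
- by rewrite /fps_comp !big_ord_recl big_ord0 /= !mul0r mul1r fps_exp1 c1 add0r addr0.
- by rewrite E -H subrr.
Qed.

(** Multiplication by 1/(1-x) takes partial sums: the numerator yields 2t+1 in degree 1 and (2t+1) -
    (2t+2) = -1 in every later degree. Hence the argument of A in the functional equation is B
    itself. *)
Lemma inner_seriesE h : inner_series h =1 Bseries h.
Proof.
have X0 := ratfun_X_neq0.
case=> [|n]; first exact: inner_series0.
rewrite /inner_series /fps_add /fps_opp /fps_scale /fps_mul /fps_geom.
rewrite big_ord_recl big_ord_recl /= /bump /=.
have E0 : fps_exp (fps_X ratfun) 2 0 = 0 by apply: fps_exp0.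
have E1 : fps_exp (fps_X ratfun) 2 1 = 0 by apply: fps_exp0.
rewrite E0 E1 /fps_X /= !(mulr0, mulr1, oppr0, addr0, add0r).
case: n => [|n].
  rewrite big_ord0 addr0 /= -[RHS](inner_coef1 X0).
  by rewrite mulr1.
rewrite /= /gcoef big_ord_recl /=.
rewrite [\sum_(i < n) _]big1 => [|i _]; last first.
  rewrite fps_expS big_ord_recl big_ord_recl /= !mul0r add0r.
  rewrite /bump /= fps_exp1 /= big1 => [|j _]; last by rewrite mul0r.
  by rewrite !(mulr0, addr0, oppr0, mul0r).
have -> : fps_exp (fps_X ratfun) 2 2 = 1.
  rewrite fps_expS !big_ord_recl big_ord0 /= /bump /= !fps_exp1 /fps_X /=.
  by rewrite !mul0r mulr1 !addr0 add0r.
move: (to_ratfun _) => F; rewrite /fps_X /=.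
rewrite -[RHS](inner_coef2 _ X0).
by rewrite !mulr1 addr0 add0r.
Qed.

Lemma inverse_pairP h : inverse_pair h <->
  forall n, Bseries h n.+2 =
    \sum_(k < n.+1) to_ratfun (h k.+1) * fps_exp (Bseries h) k.+2 n.+2.
Proof.
split=> [[_ _ /Aseries_compE H _]|H]; first exact: H.
by apply: comp_inverse_sym => //; apply/Aseries_compE.
Qed.

Lemma functional_equationP h : inverse_pair h <-> functional_equation h.
Proof.
rewrite /functional_equation (_ : inner_series h = Bseries h); last first.
  by apply/funext; exact: inner_seriesE.
by split=> [[]|] // H; apply: comp_inverse_sym.
Qed.

Lemma inverse_pair_uniq f h : inverse_pair f -> inverse_pair h ->
  forall n, (0 < n)%N -> h n = f n.
Proof.
move=> /inverse_pairP Hf /inverse_pairP Hh.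
suff E n : h n.+1 = f n.+1 by case.
elim/ltn_ind: n => n IH; apply/eqP; rewrite -(@tofrac_eq {poly R}) -/(to_ratfun _).
rewrite -/(to_ratfun (f _)).
have B i : (i < n.+2)%N -> Bseries h i = Bseries f i.
  by case: i => [|[|i]] // ni; rewrite /= /gcoef IH.
(* The top summand is [f n.+1] alone, since B^(n+2) begins with x^(n+2). *)
have ef := Hf n; rewrite big_ord_recr /= fps_exp_diag // mulr1 in ef.
have := Hh n; rewrite big_ord_recr /= fps_exp_diag // mulr1.
rewrite [X in gcoef h _ = X + _ -> _](_ : _ =
    \sum_(i < n) to_ratfun (f i.+1) * fps_exp (Bseries f) i.+2 n.+2); last first.
  apply: eq_bigr => i _; rewrite IH //; congr (_ * _).
  by apply: eq_fps_exp_ge2.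
move: ef; move: (\sum_(i < n) _) => r ef eh.
have := mul_gcoef h n.+1; have := mul_gcoef f n.+1; rewrite ef eh.
rewrite ![r + _]addrC => e1 e2; apply/eqP; exact: linear_unique e2 e1.
Qed.

(** After multiplication by t the last hypothesis says that g_(n+1) is the polynomial [b n.+2]; the
    recursion for [b] is then carried from R[t] into its fraction field. *)
Lemma inverse_pair_coefs f (b : nat -> {poly R}) : b 0%N = 0 -> b 1%N = 1 ->
  (forall n, b n.+2 = \sum_(k < n.+1) f k.+1 * fps_exp b k.+2 n.+2) ->
  (forall n, (1 + 'X) * f n.+1 = 1 + 'X * b n.+2) ->
  (forall n, gcoef f n.+1 = to_ratfun (b n.+2)) /\ inverse_pair f.
Proof.
move=> b0 b1 bE fE.
have g n : gcoef f n.+1 = to_ratfun (b n.+2).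
  apply: (mulfI ratfun_X_neq0); rewrite mul_gcoef /ratfun_X /to_ratfun.
  have := congr1 (@tofrac {poly R}) (fE n).
  rewrite !rmorphM !rmorphD !rmorph1 rmorphM /= => ->.
  by rewrite addrC addKr.
split=> //; apply/inverse_pairP => n /=.
rewrite g bE /to_ratfun raddf_sum; apply: eq_bigr => k _ /=.
rewrite rmorphM /=; congr (_ * _).
have B i : Bseries f i = tofrac (b i).
  by case: i => [|[|i]] /=; rewrite ?g // ?b0 ?b1 ?rmorph0 ?rmorph1.
elim: k.+2 n.+2 => [|m IH] i; first by rewrite /fps_exp /= /fps_one rmorph_nat.
rewrite !fps_expS raddf_sum; apply: eq_bigr => j _ /=.
by rewrite rmorphM /= B IH.
Qed.

Lemma inverse_pair_values f (b : nat -> {poly R}) : b 0%N = 0 -> b 1%N = 1 ->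
  (forall n, b n.+2 = \sum_(k < n.+1) f k.+1 * fps_exp b k.+2 n.+2) ->
  (forall n, (1 + 'X) * f n.+1 = 1 + 'X * b n.+2) ->
  [/\ f 1%N = 1, f 2%N = 1 + 2 * 'X & f 3%N = 1 + 10 * 'X + 10 * 'X^2].
Proof.
move=> b0 b1 bE fE.
have e2 := bE 0%N; have e3 := bE 1%N; have e4 := bE 2%N.
rewrite big_ord1 /= fps_exp_diag // mulr1 in e2.
rewrite !big_ord_recl big_ord0 /= fps_exp_diag // fps_exp_2_3 // addr0 mulr1 in e3.
rewrite !big_ord_recl big_ord0 /= fps_exp_diag // fps_exp_2_4 // in e4.
rewrite fps_exp_3_4 // addr0 mulr1 /bump /= in e4.
have f1 : f 1%N = 1.
  by have := fE 0%N; rewrite e2 => h; apply: (eq_from_multiple (k := 1) h); ring.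
have f2 : f 2%N = 1 + 2 * 'X.
  have := fE 1%N; rewrite e3 e2 f1 => h.
  by apply: (eq_from_multiple (k := 1) h); ring.
split=> //; have := fE 2%N; rewrite e4 e3 e2 f2 f1 => h.
by apply: (eq_from_multiple (k := 1) h); ring.
Qed.

End CosmohedronSeries.

(** * Orientation determinants and convex hulls in the plane *)

Section Orientation.
Local Open Scope classical_set_scope.
Variable R : realType.
Local Notation plane := 'rV[R]_2.
Implicit Types (x y z u v a b c : plane) (A B : set plane).

(** Twice the signed area of the triangle abc, positive when the triangle is counterclockwise. *)
Definition orient a b c : R :=
  (b 0 0 - a 0 0) * (c 0 1 - a 0 1) - (b 0 1 - a 0 1) * (c 0 0 - a 0 0).

Lemma plane_eq x y : x 0 0 = y 0 0 -> x 0 1 = y 0 1 -> x = y.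
Proof.
move=> e0 e1; apply/rowP => -[[|[|i]] ilt] //.
  by rewrite (_ : Ordinal ilt = 0) //; apply: val_inj.
by rewrite (_ : Ordinal ilt = 1) //; apply: val_inj.
Qed.

Lemma orientC a b c : orient a b c = orient b c a.
Proof. by rewrite /orient; ring. Qed.

Lemma orientN a b c : orient b a c = - orient a b c.
Proof. by rewrite /orient; ring. Qed.

Lemma orient_aab a b : orient a a b = 0.
Proof. by rewrite /orient; ring. Qed.

Lemma orient_aba a b : orient a b a = 0.
Proof. by rewrite /orient; ring. Qed.

Lemma orient_abb a b : orient a b b = 0.
Proof. by rewrite /orient; ring. Qed.

Lemma orient_conv a b x y (t : R) :
  orient a b (t *: x + (1 - t) *: y) =
  t * orient a b x + (1 - t) * orient a b y.
Proof. by rewrite /orient !mxE; ring. Qed.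

Lemma orient_shift a b x u v (t : R) :
  orient a b (x + t *: (u - v)) =
  orient a b x + t * (orient a b u - orient a b v).
Proof. by rewrite /orient !mxE; ring. Qed.

Lemma convex_setP A : convex_set A <->
  (forall x y (t : R), A x -> A y -> 0 <= t <= 1 -> A (t *: x + (1 - t) *: y)).
Proof.
split=> [cA x y t Ax Ay /andP[t0 t1]|cA x y t]; last first.
  by rewrite !inE => Ax Ay; apply: cA => //; rewrite ge0 le1.
by have := cA x y (Itv01 t0 t1); rewrite !inE; apply.
Qed.

Lemma sub_convex_hull A : A `<=` convex_hull A.
Proof. exact: sub_gen_smallest. Qed.

Lemma convex_hull_min A B : convex_set B -> A `<=` B -> convex_hull A `<=` B.
Proof. exact: smallest_sub. Qed.

Lemma convex_convex_hull A : convex_set (convex_hull A).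
Proof.
apply/convex_setP => x y t Ax Ay t01 B BA.
apply: (convex_setP B).1 => //; first by case: BA.
  exact: Ax BA.
exact: Ay BA.
Qed.

Lemma convex_hullS A B : A `<=` B -> convex_hull A `<=` convex_hull B.
Proof.
move=> AB; apply: convex_hull_min; first exact: convex_convex_hull.
exact: subset_trans AB (@sub_convex_hull B).
Qed.

Lemma convex_halfplane a b : convex_set [set x | 0 <= orient a b x].
Proof.
apply/convex_setP => x y t /= ax ay /andP[t0 t1]; rewrite orient_conv.
by rewrite addr_ge0 // mulr_ge0 // subr_ge0.
Qed.

Lemma convex_combination3 A a b c (r s t : R) : convex_set A ->
  A a -> A b -> A c -> 0 <= r -> 0 <= s -> 0 <= t -> r + s + t = 1 ->
  A (r *: a + s *: b + t *: c).
Proof.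
move=> /convex_setP cA Aa Ab Ac r0 s0 t0 e.
have [rs0|rs0] := eqVneq (r + s) 0.
  have -> : r = 0 by lra.
  have -> : s = 0 by lra.
  have -> : t = 1 by lra.
  by rewrite !scale0r !add0r scale1r.
have rsp : 0 < r + s by rewrite lt_neqAle eq_sym rs0 addr_ge0.
have -> : r *: a + s *: b + t *: c =
    (r + s) *: ((r / (r + s)) *: a + (1 - r / (r + s)) *: b) + (1 - (r + s)) *: c.
  rewrite scalerDr !scalerA.
  have -> : (r + s) * (r / (r + s)) = r by field.
  have -> : (r + s) * (1 - r / (r + s)) = s by field.
  by congr (_ + _ *: _); lra.
apply: (cA _ _ (r + s)) => //; last by lra.
apply: cA => //; rewrite divr_ge0 ?ler_pdivrMr//=; lra.
Qed.

(** The barycentric coordinates of [x] in the triangle are quotients of orientations. *)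
Lemma triangle_sub_convex A a b c x : convex_set A -> A a -> A b -> A c ->
  0 < orient a b c -> 0 <= orient a b x -> 0 <= orient b c x ->
  0 <= orient c a x -> A x.
Proof.
move=> cA Aa Ab Ac o_gt0 abx bcx cax; set o := orient a b c in o_gt0.
have o0 : o != 0 by rewrite gt_eqF.
have -> : x = (orient b c x / o) *: a + (orient c a x / o) *: b
              + (orient a b x / o) *: c.
  have E (X Y Z u v w : R) :
      X / o * u + Y / o * v + Z / o * w = (X * u + Y * v + Z * w) / o by field.
  by apply: plane_eq; rewrite !mxE E; apply: (canRL (mulfK o0));
    rewrite /o /orient; ring.
have o_ge0 := ltW o_gt0.
apply: convex_combination3 => //; rewrite ?divr_ge0//.
by rewrite -!mulrDl; apply: (canLR (mulfK o0)); rewrite mul1r /o /orient; ring.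
Qed.

End Orientation.

(** * Counterclockwise labelling of points in convex position *)

Section CyclicOrder.
Local Open Scope classical_set_scope.
Variable R : realType.
Local Notation plane := 'rV[R]_2.

Definition ccw m (p : 'I_m -> plane) : Prop :=
  forall i j k : 'I_m, (i < j)%N -> (j < k)%N -> 0 < orient (p i) (p j) (p k).

(** Dividing by the total weight exhibits [p j] as a convex combination of other vertices. The
    labels a, b, c may coincide, so collinear and repeated points are excluded by the same
    statement. *)
Lemma convex_position_weights m (p : 'I_m -> plane) (j a b c : 'I_m) (r s t : R) :
  convex_position p -> a != j -> b != j -> c != j ->
  0 <= r -> 0 <= s -> 0 <= t -> 0 < r + s + t ->
  (forall l, r * (p a 0 l - p j 0 l) + s * (p b 0 l - p j 0 l)
             + t * (p c 0 l - p j 0 l) = 0) -> False.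
Proof.
move=> cp aj bj cj r0 s0 t0; set w := r + s + t => w_gt0 e; apply: (cp j).
have w0 : w != 0 by rewrite gt_eqF.
have in_hull i : i != j -> convex_hull [set p j0 | j0 in [set j0 | j0 != j]] (p i).
  by move=> ij; apply: sub_convex_hull; exists i.
suff -> : p j = (r / w) *: p a + (s / w) *: p b + (t / w) *: p c.
  have w_ge0 := ltW w_gt0.
  apply: convex_combination3; rewrite ?divr_ge0//; try exact: in_hull.
    exact: convex_convex_hull.
  by rewrite -!mulrDl divff.
apply/rowP => l; rewrite !mxE; have := e l; rewrite /w in w0 *.
set x := p j 0 l; set xa := p a 0 l; set xb := p b 0 l; set xc := p c 0 l => e'.
apply: (mulfI w0).
have -> : (r + s + t) * (r / (r + s + t) * xa + s / (r + s + t) * xb +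
   t / (r + s + t) * xc) = r * xa + s * xb + t * xc by field.
by apply: (eq_from_multiple (k := -1) e'); ring.
Qed.

Section Sorting.
Variables (m : nat) (p : 'I_m.+1 -> plane).
Hypothesis cp : convex_position p.

Let turn i j := orient (p ord0) (p i) (p j).

Lemma turn_neq0 i j : i != ord0 -> j != ord0 -> i != j -> turn i j != 0.
Proof.
move=> i0 j0 ij; apply/eqP => o0.
pose u l := p i 0 l - p ord0 0 l; pose v l := p j 0 l - p ord0 0 l.
have uv : u 0 * v 1 = u 1 * v 0.
  by apply/eqP; rewrite -subr_eq0; apply/eqP; exact: o0.
(* [q] is the squared length of v and [d] the inner product of u and v, so collinearity gives q u =
   d v. For q = 0 two points coincide; otherwise the position of d/q relative to 0 and 1 tells which
   of the three points lies between the other two. *)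
pose d := u 0 * v 0 + u 1 * v 1; pose q := v 0 * v 0 + v 1 * v 1.
have q_ge0 : 0 <= q by rewrite addr_ge0 // -expr2 sqr_ge0.
have par l : q * u l = d * v l.
  have [->|->] : l = 0 \/ l = 1.
  - by case: l => -[|[|l]] il //; [left|right]; apply: val_inj.
  - by apply: (eq_from_multiple (k := v 1) uv); rewrite /q /d; ring.
  - by apply: (eq_from_multiple (k := - v 0) uv); rewrite /q /d; ring.
have [q0|q_neq0] := eqVneq q 0.
  have v0 l : v l = 0.
    have : v 0 ^+ 2 + v 1 ^+ 2 = 0 by rewrite !expr2.
    move/eqP; rewrite paddr_eq0 ?sqr_ge0// !sqrf_eq0 => /andP[/eqP a0 /eqP b0].
    by case: l => -[|[|l]] il //; [rewrite -[RHS]a0|rewrite -[RHS]b0];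
      congr v; apply: val_inj.
  apply: (@convex_position_weights _ p ord0 j j j 1 0 0 cp) => //; rewrite ?ler01 ?addr0 //.
  by move=> l; rewrite -/(v l) v0; ring.
have q_gt0 : 0 < q by rewrite lt_neqAle eq_sym q_neq0.
have [d_le0|d_gt0] := lerP d 0.
  apply: (@convex_position_weights _ p ord0 i j j q (- d) 0 cp) => //; try lra.
  move=> l; rewrite -/(u l) -/(v l).
  by apply: (eq_from_multiple (k := 1) (par l)); ring.
have [dq|qd] := lerP d q.
  apply: (@convex_position_weights _ p i ord0 j j (q - d) d 0 cp) => //; try lra.
  - by rewrite eq_sym.
  - by rewrite eq_sym.
  - by rewrite eq_sym.
  by move=> l; apply: (eq_from_multiple (k := -1) (par l)); rewrite /u /v; ring.
apply: (@convex_position_weights _ p j ord0 i i (d - q) q 0 cp) => //; try lra.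
- by rewrite eq_sym.
by move=> l; apply: (eq_from_multiple (k := 1) (par l)); rewrite /u /v; ring.
Qed.

(* If the cone test failed, p_0 would be a convex combination of p_i, p_j, p_k. *)
Lemma turn_trans i j k : i != ord0 -> j != ord0 -> k != ord0 ->
  0 < turn i j -> 0 < turn j k -> 0 < turn i k.
Proof.
move=> i0 j0 k0 ij jk; have [//|ik] := ltrP 0 (turn i k); exfalso.
apply: (@convex_position_weights _ p ord0 i j k (turn j k) (- turn i k) (turn i j) cp) => //.
- exact: ltW.
- by rewrite oppr_ge0.
- exact: ltW.
- by rewrite ltr_pwDr // addr_ge0 ?oppr_ge0 // ltW.
move=> l; rewrite /turn /orient; case: l => -[|[|l]] il //.
- by rewrite (_ : Ordinal il = 0); [ring|apply: val_inj].
- by rewrite (_ : Ordinal il = 1); [ring|apply: val_inj].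
Qed.

(** Otherwise the three orientations, one with its sign changed, are nonnegative weights placing
    [p j] in the triangle of [p ord0], [p i] and [p k]. *)
Lemma turn_orient i j k : i != j -> k != j -> j != ord0 -> 0 < turn i j -> 0 < turn j k ->
  0 < turn i k -> 0 < orient (p i) (p j) (p k).
Proof.
move=> ij kj j0 tij tjk tik; have [//|o_le0] := ltrP 0 (orient (p i) (p j) (p k)).
exfalso; apply: (@convex_position_weights _ p j ord0 i k
  (- orient (p i) (p j) (p k)) (turn j k) (turn i j) cp) => //.
- by rewrite eq_sym.
- by rewrite oppr_ge0.
- exact: ltW.
- exact: ltW.
- by rewrite ltr_pwDr // addr_ge0 ?oppr_ge0 // ltW.
move=> l; rewrite /turn /orient; case: l => -[|[|l]] il //.
- by rewrite (_ : Ordinal il = 0); [ring|apply: val_inj].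
- by rewrite (_ : Ordinal il = 1); [ring|apply: val_inj].
Qed.

Lemma convex_position_ccw : exists s : {perm 'I_m.+1}, ccw (p \o s).
Proof.
(* The angular order about [p ord0], with the label 0 put first; ranks in this strict total order
   give the permutation. *)
pose r i j := (j != ord0) && ((i == ord0) || (0 < turn i j)).
have r_irr i : r i i = false.
  by rewrite /r; case: eqP => //= _; rewrite /turn orient_abb ltxx.
have r_tr i j k : r i j -> r j k -> r i k.
  rewrite /r => /andP[j0 /orP[/eqP->|ij]] /andP[k0]; rewrite k0 ?eqxx//.
  rewrite (negPf j0) /=; have [//|i0] := eqVneq i ord0.
  by move=> jk; apply: turn_trans jk.
have r_tot i j : i != j -> r i j || r j i.
  rewrite /r; have [->|i0] := eqVneq i ord0; first by rewrite eq_sym => ->.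
  have [->|j0] := eqVneq j ord0; first by rewrite i0.
  move=> ij; have := turn_neq0 i0 j0 ij.
  have -> : turn j i = - turn i j by rewrite /turn /orient; ring.
  by rewrite oppr_gt0 /=; case: (ltgtP (turn i j) 0).
pose rk i := #|[pred j | r j i]|.
have rk_mono i j : r i j -> (rk i < rk j)%N.
  move=> ij; apply: proper_card; apply/properP; split.
    by apply/fintype.subsetP => k /= ki; apply: r_tr ij.
  by exists i; rewrite /= unfold_in /= ?r_irr.
have rk_lt i : (rk i < m.+1)%N.
  rewrite -[m.+1]card_ord; apply: proper_card; apply/properP.
  by split; [apply/fintype.subsetP|exists i; rewrite // unfold_in /= r_irr].
have rk_inj : injective (fun i => Ordinal (rk_lt i)).
  move=> i j [] e; apply/eqP; apply/negPn/negP => /r_tot.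
  by case/orP => /rk_mono; rewrite e ltnn.
exists (perm rk_inj)^-1%g => i j k ij jk /=.
have rE (i' j' : 'I_m.+1) : (i' < j')%N ->
    r ((perm rk_inj)^-1%g i') ((perm rk_inj)^-1%g j').
  set s := perm rk_inj => lt_ij.
  have rks l : rk (s^-1%g l) = l.
    by have := permKV s l; rewrite [s (s^-1%g l)]permE => /(congr1 val).
  have /r_tot : s^-1%g i' != s^-1%g j'.
    by rewrite (inj_eq perm_inj); apply: contraTneq lt_ij => ->; rewrite ltnn.
  by case/orP => // /rk_mono; rewrite !rks ltnNge ltnW.
have := rE _ _ ij; have := rE _ _ jk; have := rE _ _ (ltn_trans ij jk).
set a := _ i; set b := _ j; set c := _ k => rac rbc rab.
have ab : a != b by apply: contraTneq rab => ->; rewrite r_irr.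
have cb : c != b by apply: contraTneq rbc => ->; rewrite r_irr.
move: rac rbc rab; rewrite /r => /andP[c0 ac] /andP[_ bc] /andP[b0 ab'].
move: bc; rewrite (negPf b0) => /= bc.
move: ac ab'; have [a0 _ _|a0 /= ac ab'] := eqVneq a ord0; first by rewrite a0.
exact: turn_orient.
Qed.

End Sorting.
End CyclicOrder.

(** * Interiors of convex sets, reached by small displacements *)

Definition eventually0 (R : realType) (P : R -> Prop) : Prop :=
  exists2 e0 : R, 0 < e0 & forall e, 0 < e -> e < e0 -> P e.

Section Eventually0.
Variable R : realType.
Implicit Types (P Q : R -> Prop) (r s : R).

Lemma eventually0_and P Q :
  eventually0 P -> eventually0 Q -> eventually0 (fun e => P e /\ Q e).
Proof.
move=> [e1 e1_gt0 H1] [e2 e2_gt0 H2]; exists (Num.min e1 e2).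
  by rewrite lt_min e1_gt0.
by move=> e e_gt0; rewrite lt_min => /andP[ee1 ee2]; split; [apply: H1|apply: H2].
Qed.

Lemma eventually0_mono P Q : (forall e, 0 < e -> P e -> Q e) ->
  eventually0 P -> eventually0 Q.
Proof. by move=> PQ [e1 e1_gt0 H1]; exists e1 => // e e0 ee; apply/PQ/H1. Qed.

Lemma eventually0_ex P : eventually0 P -> exists2 e, 0 < e & P e.
Proof.
move=> [e e_gt0 H]; exists (e / 2); first by rewrite divr_gt0.
by apply: H; [rewrite divr_gt0|rewrite ltr_pdivrMr// ltr_pMr// ltr1n].
Qed.

Lemma eventually0_lt r : 0 < r -> eventually0 (fun e => e < r).
Proof. by exists r. Qed.

Lemma eventually0_affine_gt0 r s : 0 < r -> eventually0 (fun e => 0 < r + e * s).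
Proof.
move=> r_gt0; have s1 : 0 < 1 + `|s| by rewrite ltr_pwDl.
exists (r / (1 + `|s|)) => [|e e0]; first by rewrite divr_gt0.
rewrite ltr_pdivlMr // => er.
have : e * - s <= e * `|s|
  by apply: ler_wpM2l; [exact: ltW|rewrite -normrN ler_norm].
by rewrite mulrN; lra.
Qed.

Lemma eventually0_seq (T : eqType) (l : seq T) (Q : T -> R -> Prop) :
  (forall t, t \in l -> eventually0 (Q t)) ->
  eventually0 (fun e => forall t, t \in l -> Q t e).
Proof.
elim: l => [|t l IH] H; first by exists 1.
have H1 := H t (mem_head _ _).
have H2 : eventually0 (fun e => forall t, t \in l -> Q t e).
  by apply: IH => u ul; apply: H; rewrite in_cons ul orbT.
apply: eventually0_mono (eventually0_and H1 H2) => e _ [Qt Ql] u.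
by rewrite in_cons => /orP[/eqP->|/Ql].
Qed.

End Eventually0.

Section Interiors.
Variable R : realType.
Local Notation plane := 'rV[R]_2.
Local Open Scope classical_set_scope.
Implicit Types (x y z u v a b c : plane) (A B : set plane).

Lemma interior_ray A x v : A° x -> eventually0 (fun e : R => A (x + e *: v)).
Proof.
move=> Ax; have v1 : 0 < 1 + `|v| by rewrite ltr_pwDl.
case/nbhs_ballP: Ax => r /= r_gt0 rA.
exists (r / (1 + `|v|)) => [|e e0]; first by rewrite divr_gt0.
rewrite ltr_pdivlMr // => er; apply: rA; rewrite -ball_normE /=.
rewrite opprD addrA subrr sub0r normrN normrZ gtr0_norm//.
by apply: le_lt_trans er; apply: ler_wpM2l; [exact: ltW|rewrite lerDr].
Qed.

Lemma interior_halfplane A a b x : a != b ->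
  (forall y, A y -> orient a b y <= 0) -> A° x -> orient a b x < 0.
Proof.
(* [v] is the normal to ab pointing to its left, so moving an interior point along [v] strictly
   increases [orient a b]. *)
move=> ab Aab Ax; pose v : plane := \row_j (if j == 0 then a 0 1 - b 0 1 else b 0 0 - a 0 0).
have v_gt0 : 0 < orient a b (a + v).
  have -> : orient a b (a + v) = (b 0 0 - a 0 0) ^+ 2 + (b 0 1 - a 0 1) ^+ 2.
    by rewrite /orient !mxE /=; ring.
  rewrite lt_neqAle addr_ge0 ?sqr_ge0// andbT eq_sym paddr_eq0 ?sqr_ge0//.
  apply: contra ab; rewrite !sqrf_eq0 !subr_eq0 => /andP[/eqP e0 /eqP e1].
  by apply/eqP/plane_eq.
have [e e_gt0 /Aab] := eventually0_ex (interior_ray v Ax).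
have -> : orient a b (x + e *: v) = orient a b x + e * orient a b (a + v).
  by rewrite /orient !mxE; ring.
have : 0 < e * orient a b (a + v) by rewrite mulr_gt0.
by lra.
Qed.

Lemma orient_continuous a b : continuous (orient a b : plane -> R).
Proof.
have C (r s : R) (i : 'I_2) : continuous (fun y : plane => r * (y 0 i - s)).
  move=> x; apply: (@continuousM R plane (fun=> r) _ x).
    exact: cst_continuous.
  apply: (@continuousB R R^o plane (fun y => y 0 i) (fun=> s)).
    exact: coord_continuous.
  exact: cst_continuous.
move=> x; apply: (@continuousB R R^o plane
  (fun y : plane => (b 0 0 - a 0 0) * (y 0 1 - a 0 1))); exact: C.
Qed.

(** The factor [orient a b c] makes the test independent of the sense in which the triangle is
    traversed. *)
Definition in_triangle a b c x : Prop :=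
  [/\ 0 < orient a b c * orient a b x, 0 < orient a b c * orient b c x
    & 0 < orient a b c * orient c a x].

Lemma in_triangle_interior A a b c x : convex_set A -> A a -> A b -> A c ->
  in_triangle a b c x -> A° x.
Proof.
move=> cA Aa Ab Ac abcx.
pose U u v := [set y | 0 < orient a b c * orient u v y].
have oU u v : open (U u v).
  apply: (@open_comp _ _ (fun y => orient a b c * orient u v y) [set r | 0 < r]).
    move=> y _; apply: (@continuousM R plane (fun=> orient a b c) _ y).
      exact: cst_continuous.
    exact: orient_continuous.
  exact: open_gt.
suff sA : U a b `&` U b c `&` U c a `<=` A.
  have : open (U a b `&` U b c `&` U c a) by do ?apply: openI.
  by move/open_subsetE => E; move: sA; rewrite E; apply; case: abcx.
move=> y [[]]; rewrite /U /= => aby bcy cay.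
have [lt_o0|gt_o0|o0] := ltrgtP (orient a b c) 0.
- move: aby bcy cay; rewrite !nmulr_rgt0 // => aby bcy cay.
  apply: (@triangle_sub_convex _ A b a c) => //; rewrite orientN ?oppr_gt0 ?oppr_ge0 ?ltW//.
- move: aby bcy cay; rewrite !pmulr_rgt0 // => aby bcy cay.
  by apply: (@triangle_sub_convex _ A a b c) => //; rewrite ltW.
- by move: aby; rewrite o0 mul0r ltxx.
Qed.

(** At a point inside the edge ab the tests for the other two edges are already strict and survive
    small moves; the test for ab is zero there and becomes positive at once along [v]. *)
Lemma in_triangle_ray a b c x v : a != b -> orient a b c != 0 ->
  (exists2 t : R, 0 < t < 1 & x = t *: a + (1 - t) *: b) ->
  0 < orient a b c * (orient a b (x + v) - orient a b x) ->
  eventually0 (fun e => in_triangle a b c (x + e *: v)).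
Proof.
move=> ab o0 [t /andP[t0 t1] xE] ov.
have sh u w e : orient u w (x + e *: v) = orient u w x + e * (orient u w (x + v) - orient u w x).
  by rewrite /orient !mxE; ring.
have o_sq : 0 < orient a b c * orient a b c.
  by rewrite -expr2 lt_neqAle sqr_ge0 eq_sym sqrf_eq0 o0.
have ibc : 0 < orient a b c * orient b c x.
  have -> : orient b c x = t * orient a b c.
    by rewrite xE /orient !mxE; ring.
  by rewrite mulrCA mulr_gt0.
have ica : 0 < orient a b c * orient c a x.
  have -> : orient c a x = (1 - t) * orient a b c.
    by rewrite xE /orient !mxE; ring.
  by rewrite mulrCA mulr_gt0 // subr_gt0.
have := eventually0_and
  (eventually0_affine_gt0 (orient a b c * (orient b c (x + v) - orient b c x)) ibc)
  (eventually0_affine_gt0 (orient a b c * (orient c a (x + v) - orient c a x)) ica).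
apply: eventually0_mono => e e0 [e1 e2]; split; rewrite sh mulrDr.
- have abx : orient a b x = 0 by rewrite xE /orient !mxE; ring.
  rewrite abx in ov *; by rewrite mulr0 add0r mulrCA mulr_gt0.
- by rewrite (mulrCA _ e).
- by rewrite (mulrCA _ e).
Qed.

(* Where segments ab and cd cross, move off ab towards e and off cd towards f. *)
Lemma crossing_interiors A B a b e c d f : convex_set A -> convex_set B ->
  A a -> A b -> A e -> B c -> B d -> B f ->
  orient a b e != 0 -> orient c d f != 0 ->
  orient a b c * orient a b d < 0 -> orient c d a * orient c d b < 0 ->
  exists x, A° x /\ B° x.
Proof.
move=> cA cB Aa Ab Ae Bc Bd Bf abe cdf abcd cdab.
have ratio (r s : R) : r * s < 0 -> r - s != 0 /\ 0 < s / (s - r) < 1.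
  move=> rs; have rs0 : s - r != 0.
    by apply: contraTneq rs => /eqP; rewrite subr_eq0 => /eqP->; rewrite -leNgt -expr2 sqr_ge0.
  split; first by rewrite -oppr_eq0 opprB.
  have [r0|r0] := ltrP r 0.
    have s0 : 0 < s by rewrite -(nmulr_rlt0 _ r0).
    by rewrite divr_gt0 ?ltr_pdivrMr; lra.
  have r1 : 0 < r by rewrite lt_neqAle r0 andbT; apply: contraTneq rs => <-; rewrite mul0r ltxx.
  have s0 : s < 0 by rewrite -(pmulr_rlt0 _ r1).
  rewrite -mulrNN -invrN divr_gt0 ?ltr_pdivrMr; lra.
have [c0 c01] := ratio _ _ cdab; have [a0 a01] := ratio _ _ abcd.
(* [t] and [s] are the parameters of the crossing point on ab and on cd: at [t] the affine function
   [orient c d] vanishes on ab, and at [s] the function [orient a b] vanishes on cd. *)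
set t := _ / _ in c01; set s := _ / _ in a01.
pose x := t *: a + (1 - t) *: b.
have xE : x = s *: c + (1 - s) *: d.
  move: a0 c0; rewrite /x /t /s /orient => a0 c0.
  by apply: plane_eq; rewrite !mxE; field; apply/andP; split; apply: contraNneq a0 || apply: contraNneq c0; lra.
(* A move along b - a does not change [orient a b], and one along d - c does not change
   [orient c d]. The two coefficients can thus be chosen separately, each with the sign that turns
   the required test into a nonzero square. *)
pose k1 := orient a b e * (orient a b d - orient a b c).
pose k2 := orient c d f * (orient c d b - orient c d a).
pose v := k1 *: (d - c) + k2 *: (b - a).
have sq_gt0 (q r : R) : q != 0 -> r != 0 -> 0 < q * (q * r * r).
  move=> q0 r0; rewrite (_ : q * _ = (q * r) ^+ 2); last by ring.
  by rewrite lt_neqAle sqr_ge0 eq_sym sqrf_eq0 mulf_neq0.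
have H1 : eventually0 (fun r => in_triangle a b e (x + r *: v)).
  apply: in_triangle_ray => //.
  - by apply: contraNneq abe => ->; rewrite orient_aab.
  - by exists t.
  have -> : orient a b (x + v) - orient a b x = k1 * (orient a b d - orient a b c).
    by rewrite /v /orient !mxE; ring.
  by rewrite sq_gt0 // -oppr_eq0 opprB.
have H2 : eventually0 (fun r => in_triangle c d f (x + r *: v)).
  apply: in_triangle_ray => //.
  - by apply: contraNneq cdf => ->; rewrite orient_aab.
  - by exists s.
  have -> : orient c d (x + v) - orient c d x = k2 * (orient c d b - orient c d a).
    by rewrite /v /orient !mxE; ring.
  by rewrite sq_gt0 // -oppr_eq0 opprB.
have [r r0 [ix1 ix2]] := eventually0_ex (eventually0_and H1 H2).
by exists (x + r *: v); split; [exact: in_triangle_interior ix1|exact: in_triangle_interior ix2].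
Qed.

(** The midpoint of ab, pushed towards [e], enters the triangles abe and abf together, as [e] and
    [f] lie on the same side. *)
Lemma common_edge_interiors A B a b e f : convex_set A -> convex_set B ->
  A a -> A b -> A e -> B a -> B b -> B f ->
  0 < orient a b e * orient a b f -> exists x, A° x /\ B° x.
Proof.
move=> cA cB Aa Ab Ae Ba Bb Bf ef.
have e0 : orient a b e != 0 by apply: contraTneq ef => ->; rewrite mul0r ltxx.
have f0 : orient a b f != 0 by apply: contraTneq ef => ->; rewrite mulr0 ltxx.
have ab : a != b by apply: contraNneq e0 => ->; rewrite orient_aab.
pose x := (1 / 2) *: a + (1 - 1 / 2) *: b.
have xE : exists2 t : R, 0 < t < 1 & x = t *: a + (1 - t) *: b.
  by exists (1 / 2) => //; lra.
have x0 : orient a b x = 0 by rewrite /x /orient !mxE; ring.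
have xe : orient a b (x + (e - x)) - orient a b x = orient a b e.
  by rewrite x0 subr0 addrC subrK.
have H1 : eventually0 (fun r => in_triangle a b e (x + r *: (e - x))).
  by apply: in_triangle_ray => //; rewrite xe -expr2 lt_neqAle sqr_ge0 eq_sym sqrf_eq0 e0.
have H2 : eventually0 (fun r => in_triangle a b f (x + r *: (e - x))).
  by apply: in_triangle_ray => //; rewrite xe mulrC.
have [r r0 [ix1 ix2]] := eventually0_ex (eventually0_and H1 H2).
by exists (x + r *: (e - x)); split; [exact: in_triangle_interior ix1|exact: in_triangle_interior ix2].
Qed.

End Interiors.

(** * Subdivisions encoded by vertex sets, and cuts along chords *)

Section Subdivisions.
Variables (R : realType) (m : nat) (p : 'I_m -> 'rV[R]_2).
Hypotheses (p_convex : convex_position p) (p_ccw : ccw p).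
Implicit Types (S T Y Z : {set 'I_m}) (D : {set {set 'I_m}}).
Implicit Types (i j k a b : 'I_m) (x y u v : 'rV[R]_2).

Definition hull S : set 'rV[R]_2 := convex_hull (p @` [set` S])%classic.

Lemma convex_set_hull S : convex_set (hull S).
Proof. exact: convex_convex_hull. Qed.

Lemma mem_hull S k : k \in S -> hull S (p k).
Proof. by move=> kS; apply: sub_convex_hull; exists k. Qed.

Lemma hullS S T : S \subset T -> (hull S `<=` hull T)%classic.
Proof.
move=> /fintype.subsetP ST; apply: convex_hullS => _ [k /= kS <-].
by exists k => //=; exact: ST.
Qed.

Lemma hull_ge0 S u v : (forall k, k \in S -> 0 <= orient u v (p k)) ->
  forall x, hull S x -> 0 <= orient u v x.
Proof.
move=> H x Sx; have := convex_hull_min (@convex_halfplane R u v) _ Sx; apply.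
by move=> _ [k /= kS <-]; exact: H.
Qed.

Lemma hull_le0 S u v : (forall k, k \in S -> orient u v (p k) <= 0) ->
  forall x, hull S x -> orient u v x <= 0.
Proof.
move=> H x Sx; rewrite -oppr_ge0 -orientN; apply: hull_ge0 Sx => k kS.
by rewrite orientN oppr_ge0 H.
Qed.

(** Convex position lets a vertex set be read off its hull, so sets of labels encode subpolygons
    faithfully. *)
Lemma hull_vertex S i : hull S (p i) -> i \in S.
Proof.
move=> Spi; apply: contrapT => iS; apply: (@p_convex i).
apply: convex_hullS Spi => _ [k /= kS <-]; exists k => //=.
by apply/eqP => ki; apply: iS; rewrite -ki.
Qed.

Lemma hull_subset S T : (hull S `<=` hull T)%classic -> S \subset T.
Proof. by move=> ST; apply/fintype.subsetP => k /mem_hull/ST/hull_vertex. Qed.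

Lemma hull_inj : injective hull.
Proof.
by move=> S T ST; apply/eqP; rewrite finset.eqEsubset !hull_subset // ST.
Qed.

Lemma orient_inside i j k : (i < k)%N -> (k < j)%N ->
  orient (p i) (p j) (p k) < 0.
Proof.
by move=> ik kj; rewrite orientC orientN -orientC oppr_lt0; apply: p_ccw.
Qed.

Lemma orient_outside i j k : (i < j)%N -> (k < i)%N || (j < k)%N ->
  0 < orient (p i) (p j) (p k).
Proof.
by move=> ij /orP[ki|jk]; [rewrite -orientC|]; apply: p_ccw.
Qed.

Lemma orient_ge0 i j k : (i < j)%N -> ~~ ((i < k)%N && (k < j)%N) ->
  0 <= orient (p i) (p j) (p k).
Proof.
move=> ij H; have [->|ki] := eqVneq k i; first by rewrite orient_aba.
have [->|kj] := eqVneq k j; first by rewrite orient_abb.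
apply/ltW/orient_outside => //; move: H ki kj; rewrite -!val_eqE /=; lia.
Qed.

Lemma orient_le0 i j k : (i <= k)%N -> (k <= j)%N ->
  orient (p i) (p j) (p k) <= 0.
Proof.
move=> ik kj; have [->|ki] := eqVneq k i; first by rewrite orient_aba.
have [->|kj'] := eqVneq k j; first by rewrite orient_abb.
by apply/ltW/orient_inside; move: ik kj ki kj'; rewrite -!val_eqE /=; lia.
Qed.

Lemma ord_strictly_between i j k :
  (i <= k)%N && (k <= j)%N -> k != i -> k != j -> (i < k)%N && (k < j)%N.
Proof. by rewrite -!val_eqE /=; lia. Qed.

Lemma orient_neq0 i j k : i != j -> k != i -> k != j ->
  orient (p i) (p j) (p k) != 0.
Proof.
wlog ij : i j / (i < j)%N => [H|].
  move=> ij ki kj; have [lt|lt|/val_inj e] := ltngtP i j.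
  - exact: H.
  - by rewrite orientN oppr_eq0 H // eq_sym.
  - by rewrite e eqxx in ij.
move=> _ ki kj; have [ik|ki'] := ltnP i k.
  have [kj'|jk] := ltnP k j; first by rewrite lt_eqF // orient_inside.
  rewrite gt_eqF // orient_outside //; move: jk kj; rewrite -!val_eqE /=; lia.
rewrite gt_eqF // orient_outside //; move: ki' ki; rewrite -!val_eqE /=; lia.
Qed.

Lemma vertex_neq i j : (2 < m)%N -> i != j -> p i != p j.
Proof.
move=> m3 ij; have : (2 < #|[set: 'I_m]|)%N by rewrite cardsT card_ord.
rewrite (cardsD1 i) (cardsD1 j) !inE /= eq_sym ij !ltnS => /card_gt0P[k].
rewrite !inE andbT => /andP[kj ki].
by apply: contra_neq (orient_neq0 ij ki kj) => ->; rewrite orient_aab.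
Qed.

Lemma card_ge3_ex S a b : (2 < #|S|)%N -> exists k, [/\ k \in S, k != a & k != b].
Proof.
rewrite (cardsD1 a) (cardsD1 b) => H.
have /card_gt0P[k] : (0 < #|S :\ a :\ b|)%N.
  move: H; move: #|_ :\ b| => n.
  by case: (a \in S); case: (b \in S :\ a); case: n.
by rewrite !inE => /and3P[kb ka kS]; exists k.
Qed.

Lemma set_min S : S != finset.set0 -> exists2 a, a \in S & forall k, k \in S -> (a <= k)%N.
Proof.
case/set0Pn => i iS; have [a aS H] := @arg_minnP _ i (mem S) (@nat_of_ord m) iS.
by exists a.
Qed.

Lemma set_max S : S != finset.set0 -> exists2 b, b \in S & forall k, k \in S -> (k <= b)%N.
Proof.
case/set0Pn => i iS; have [b bS H] := @arg_maxnP _ i (mem S) (@nat_of_ord m) iS.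
by exists b.
Qed.

Lemma set_next S a b : b \in S -> (a < b)%N ->
  exists2 l, l \in S & (a < l <= b)%N /\ forall k, k \in S -> ~~ ((a < k)%N && (k < l)%N).
Proof.
move=> bS ab; pose P k := (k \in S) && (a < k)%N.
have Pb : P b by rewrite /P bS.
have [l /andP[lS al] H] := arg_minnP (@nat_of_ord m) Pb.
exists l => //; split=> [|k kS]; first by rewrite al /= H.
by apply/negP => /andP[ak kl]; have := H k; rewrite /P kS ak leqNgt kl => /(_ isT).
Qed.

(* x lies in one of the triangles fanning out from the smallest vertex. *)
Lemma hull_edges S x : (2 < #|S|)%N ->
  (forall i j, i \in S -> j \in S -> (i < j)%N ->
     (forall k, k \in S -> ~~ ((i < k)%N && (k < j)%N)) ->
     0 <= orient (p i) (p j) x) ->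
  (forall i j, i \in S -> j \in S ->
     (forall k, k \in S -> (i <= k)%N && (k <= j)%N) ->
     orient (p i) (p j) x <= 0) -> hull S x.
Proof.
move=> S3 edge long; have S0 : S != finset.set0 by rewrite -card_gt0; lia.
have [a aS amin] := set_min S0; have [b bS bmax] := set_max S0.
have [z [zS za zb]] := card_ge3_ex a b S3.
have az : (a < z)%N by rewrite ltn_neqAle amin // andbT eq_sym.
have zb' : (z < b)%N by rewrite ltn_neqAle bmax // andbT.
have [s sS [/andP[as_ sz] snext]] := set_next zS az.
(* The fan triangle containing [x] has vertices a, k, l, where [k] is the last vertex with [x] to
   the left of the ray from a, and [l] follows [k]. The third inequality comes from maximality of
   [k], or from the long edge if [l] is the last vertex. *)
pose P k := [&& k \in S, (a < k)%N, (k < b)%N & 0 <= orient (p a) (p k) x].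
have Ps : P s by rewrite /P sS as_ (leq_ltn_trans sz zb') edge.
have [k /and4P[kS ak kb ox] kmax] := arg_maxnP (@nat_of_ord m) Ps.
have [l lS [/andP[kl lb] lnext]] := set_next bS kb.
have al := ltn_trans ak kl.
apply: (@triangle_sub_convex _ _ (p a) (p k) (p l)) => //;
  try exact: mem_hull; try exact: convex_set_hull.
- exact: p_ccw.
- exact: edge.
rewrite orientN oppr_ge0; have [lb'|bl] := ltnP l b.
  rewrite leNgt; apply/negP => /ltW ol.
  by have /= := kmax l; rewrite /P lS al lb' ol leqNgt kl => /(_ isT).
have -> : l = b by apply: val_inj; apply: anti_leq; rewrite lb.
by apply: long => // q qS; rewrite amin ?bmax.
Qed.

Lemma hull_edge_ge0 S i j x : hull S x -> (i < j)%N ->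
  (forall k, k \in S -> ~~ ((i < k)%N && (k < j)%N)) -> 0 <= orient (p i) (p j) x.
Proof. by move=> Sx ij H; apply: hull_ge0 Sx => k /H; exact: orient_ge0. Qed.

Lemma hull_long_le0 S i j x : hull S x ->
  (forall k, k \in S -> (i <= k)%N && (k <= j)%N) -> orient (p i) (p j) x <= 0.
Proof. by move=> Sx H; apply: hull_le0 Sx => k /H/andP[]; exact: orient_le0. Qed.

(** Both sides of the chord keep the endpoints a and b, so the chord becomes an edge of each of
    them. *)
Definition inner S a b := [set k in S | (a <= k)%N && (k <= b)%N]%SET.
Definition outer S a b := [set k in S | ~~ ((a < k)%N && (k < b)%N)]%SET.

Lemma inner_sub S a b : inner S a b \subset S.
Proof. by apply/fintype.subsetP => k; rewrite inE => /andP[]. Qed.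

Lemma outer_sub S a b : outer S a b \subset S.
Proof. by apply/fintype.subsetP => k; rewrite inE => /andP[]. Qed.

(** The side of the line ab on which [x] lies decides; every edge of that part is either an edge of
    S or the chord. If one side has no further vertex, the other is all of S. *)
Lemma hull_cut S a b x : (2 < #|S|)%N -> a \in S -> b \in S -> (a < b)%N ->
  hull S x -> (2 < #|inner S a b|)%N /\ hull (inner S a b) x \/
              (2 < #|outer S a b|)%N /\ hull (outer S a b) x.
Proof.
move=> S3 aS bS ab Sx.
have [out_S|] := boolP [forall k in S, ~~ ((a < k)%N && (k < b)%N)].
  right; suff -> : outer S a b = S by [].
  apply/setP => k; rewrite inE; case kS: (k \in S) => //=.
  by have := forallP out_S k; rewrite kS.
rewrite negb_forall_in => /exists_inP[c cS]; rewrite negbK => /andP[ac cb].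
have [in_S|] := boolP [forall k in S, (a <= k)%N && (k <= b)%N].
  left; suff -> : inner S a b = S by [].
  apply/setP => k; rewrite inE; case kS: (k \in S) => //=.
  by have := forallP in_S k; rewrite kS.
rewrite negb_forall_in => /exists_inP[d dS dout].
have third T k : a \in T -> b \in T -> k \in T -> k != a -> k != b -> (2 < #|T|)%N.
  move=> aT bT kT ka kb; rewrite (cardsD1 a) (cardsD1 b) (cardsD1 k) !inE aT bT kT.
  by rewrite ka kb -val_eqE /= gtn_eqF.
have in3 : (2 < #|inner S a b|)%N.
  apply: (third _ c); rewrite ?inE ?aS ?bS ?cS -?val_eqE /=; move: ac cb ab; clear; lia.
have out3 : (2 < #|outer S a b|)%N.
  apply: (third _ d); rewrite ?inE ?aS ?bS ?dS -?val_eqE /=; move: dout ab; clear; lia.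
have [ox|ox] := lerP (orient (p a) (p b) x) 0; [left|right]; split=> //.
  apply: hull_edges => // i j; rewrite !inE => /andP[iS iin] /andP[jS jin].
    move=> ij H; apply: (hull_edge_ge0 Sx ij) => k kS.
    by have := H k; rewrite inE kS /=; move: iin jin; clear; lia.
  move=> H; have Ha := H a; have Hb := H b; rewrite !inE aS bS /= in Ha Hb.
  have -> : i = a by apply: val_inj; move: Ha Hb iin jin ab; clear => /=; lia.
  have -> : j = b by apply: val_inj; move: Ha Hb iin jin ab; clear => /=; lia.
  exact: ox.
apply: hull_edges => // i j; rewrite !inE => /andP[iS iout] /andP[jS jout].
  move=> ij H.
  have [/andP[/eqP -> /eqP ->]|nab] := boolP ((i == a) && (j == b)); first exact: ltW.
  apply: (hull_edge_ge0 Sx ij) => k kS; apply/negP => kij.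
  have := H k; have := H a; have := H b; rewrite !inE aS bS kS /=.
  by move: iout jout kij nab ab; clear; rewrite -!val_eqE /=; lia.
move=> H; apply: (hull_long_le0 Sx) => k kS.
have := H k; have := H a; have := H b; rewrite !inE aS bS kS /=.
by move: iout jout ab; clear; lia.
Qed.

(** Covering is required only from three vertices on, so a set of at most two vertices has the empty
    family as its only subdivision. This represents an edge to which nothing is glued. *)
Definition subdivides S D : Prop :=
  [/\ forall Y, Y \in D -> Y \subset S /\ (2 < #|Y|)%N,
      (2 < #|S|)%N -> forall x, hull S x -> exists2 Y, Y \in D & hull Y x
    & forall Y Z, Y \in D -> Z \in D ->
        (exists x, (hull Y)°%classic x /\ (hull Z)°%classic x) -> Y = Z].

Lemma hull_interior S : (2 < #|S|)%N -> exists x, (hull S)°%classic x.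
Proof.
move=> S3; have /card_gt0P[a aS] : (0 < #|S|)%N by lia.
have [b [bS ba _]] := card_ge3_ex a a S3.
have [c [cS ca cb]] := card_ge3_ex a b S3.
have o0 : orient (p a) (p b) (p c) != 0 by rewrite orient_neq0 // eq_sym.
have [|x [Sx _]] := @common_edge_interiors _ (hull S) (hull S) (p a) (p b) (p c) (p c)
  (@convex_set_hull S) (@convex_set_hull S) (mem_hull aS) (mem_hull bS) (mem_hull cS)
  (mem_hull aS) (mem_hull bS) (mem_hull cS).
  by rewrite -expr2 lt_neqAle sqr_ge0 eq_sym sqrf_eq0 o0.
by exists x.
Qed.

Lemma subdivides_disjoint S D Y Z T : subdivides S D -> Y \in D -> Z \in D ->
  T \subset Y -> T \subset Z -> (2 < #|T|)%N -> Y = Z.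
Proof.
move=> [_ _ H] YD ZD TY TZ /hull_interior[x Tx]; apply: H => //.
by exists x; split; [apply: (interiorS (hullS TY)) Tx|apply: (interiorS (hullS TZ)) Tx].
Qed.

Lemma subdivides1 S : (2 < #|S|)%N -> subdivides S [set S]%SET.
Proof.
move=> S3; split=> [Y|_ x Sx|Y Z]; rewrite ?inE.
- by move/eqP ->.
- by exists S; rewrite ?inE.
- by move=> /eqP -> /eqP ->.
Qed.

Lemma subdivides_small S D : (#|S| <= 2)%N -> subdivides S D <-> D = finset.set0.
Proof.
move=> S2; split=> [[H _ _]|->].
  apply/eqP; apply: contraT => /set0Pn[Y /H[/subset_leq_card YS Y3]].
  by have := leq_trans Y3 (leq_trans YS S2).
by split=> [Y|S3|Y Z]; rewrite ?inE //; rewrite ltnNge S2 in S3.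
Qed.

(** Some piece covers the midpoint of the edge ab. A piece missing a or b meets the line ab in at
    most one vertex and cannot contain that midpoint. *)
Lemma subdivides_root S D a b : subdivides S D -> (2 < #|S|)%N ->
  a \in S -> b \in S -> (forall k, k \in S -> (a <= k)%N && (k <= b)%N) ->
  exists T, [/\ T \in D, a \in T & b \in T].
Proof.
move=> [DS cov _] S3 aS bS ab.
have [z [zS za zb]] := card_ge3_ex a b S3.
have /andP[az zb'] := ord_strictly_between (ab z zS) za zb.
have lt_ab := ltn_trans az zb'.
have m3 : (2 < m)%N by apply: leq_trans S3 _; rewrite -[m in (_ <= m)%N]card_ord max_card.
have pab : p a != p b by apply: vertex_neq => //; rewrite -val_eqE /= ltn_eqF.
pose x := (1 / 2) *: p a + (1 - 1 / 2) *: p b.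
have Sx : hull S x.
  by apply: (convex_setP _).1 (mem_hull aS) (mem_hull bS) _; [exact: convex_set_hull|lra].
have ox : orient (p a) (p b) x = 0 by rewrite /x /orient !mxE; ring.
have [T TD Tx] := cov S3 x Sx; have [TS _] := DS T TD.
(* An open half-plane together with one boundary point is convex. *)
have face c : (p c == p a) || (p c == p b) -> x <> p c ->
    (forall k, k \in T -> k != c -> orient (p a) (p b) (p k) < 0) -> False.
  move=> pc xc H; pose A : set 'rV[R]_2 := [set y | orient (p a) (p b) y < 0 \/ y = p c]%classic.
  have oc : orient (p a) (p b) (p c) = 0.
    by case/orP: pc => /eqP ->; rewrite ?orient_aba ?orient_abb.
  have cA : convex_set A.
    apply/convex_setP => y w t Ay Aw /andP[t0 t1].
    have [->|t0'] := eqVneq t 0; first by rewrite scale0r add0r subr0 scale1r.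
    have [->|t1'] := eqVneq t 1; first by rewrite subrr scale0r addr0 scale1r.
    have t_gt0 : 0 < t by rewrite lt_neqAle eq_sym t0'.
    have t_lt1 : 0 < 1 - t by rewrite subr_gt0 lt_neqAle t1'.
    rewrite /A /= orient_conv; case: Ay => [oy|->]; case: Aw => [ow|->].
    - by left; rewrite -oppr_gt0 opprD -!mulrN addr_gt0 // mulr_gt0 // oppr_gt0.
    - by left; rewrite oc mulr0 addr0 pmulr_rlt0.
    - by left; rewrite oc mulr0 add0r pmulr_rlt0.
    - by right; rewrite -scalerDl addrC subrK scale1r.
  have : A x.
    have := convex_hull_min cA _ Tx; apply => _ [k /= kT <-].
    by have [->|kc] := eqVneq k c; [right|left; apply: H].
  by case; rewrite ?ox ?ltxx.
have onlt k : k \in T -> k != a -> k != b -> orient (p a) (p b) (p k) < 0.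
  move=> kT ka kb.
  have /andP[] := ord_strictly_between (ab k (fintype.subsetP TS k kT)) ka kb.
  exact: orient_inside.
have xa : x <> p a.
  move=> e; case/eqP: pab; apply: plane_eq;
    [have := congr1 (fun M : 'rV[R]_2 => M 0 0) e|have := congr1 (fun M : 'rV[R]_2 => M 0 1) e];
    rewrite /x !mxE; lra.
have xb : x <> p b.
  move=> e; case/eqP: pab; apply: plane_eq;
    [have := congr1 (fun M : 'rV[R]_2 => M 0 0) e|have := congr1 (fun M : 'rV[R]_2 => M 0 1) e];
    rewrite /x !mxE; lra.
exists T; split=> //; apply: contraT => nT; exfalso.
  apply: (face b) => [||k kT kb]; rewrite ?eqxx ?orbT //.
  by apply: onlt => //; apply: contraNneq nT => <-.
apply: (face a) => [||k kT ka]; rewrite ?eqxx ?orbT //.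
by apply: onlt => //; apply: contraNneq nT => <-.
Qed.

Lemma subdivides_root_uniq S D a b Y Z : subdivides S D ->
  (forall k, k \in S -> (a <= k)%N && (k <= b)%N) ->
  Y \in D -> Z \in D -> a \in Y -> b \in Y -> a \in Z -> b \in Z -> Y = Z.
Proof.
move=> [DS _ dis] ab YD ZD aY bY aZ bZ.
have [YS Y3] := DS Y YD; have [ZS Z3] := DS Z ZD.
have neg T : T \subset S -> (2 < #|T|)%N ->
    exists2 e, e \in T & orient (p a) (p b) (p e) < 0.
  move=> TS T3; have [e [eT ea eb]] := card_ge3_ex a b T3; exists e => //.
  have /andP[] := ord_strictly_between (ab e (fintype.subsetP TS e eT)) ea eb.
  exact: orient_inside.
have [e eY oe] := neg Y YS Y3; have [f fZ of_] := neg Z ZS Z3.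
apply: dis => //; apply: (@common_edge_interiors _ _ _ (p a) (p b) (p e) (p f));
  try exact: convex_set_hull; try exact: mem_hull.
by rewrite nmulr_rgt0.
Qed.

(** A piece with vertices [c], [d] on both sides of ab has a segment cd crossing ab. Its interior
    then meets that of [T], so it equals [T], but [T] stays on the outer side. *)
Lemma subdivides_uncrossed S D a b T Y : subdivides S D -> T \in D ->
  a \in T -> b \in T -> (a < b)%N -> T \subset outer S a b -> Y \in D ->
  Y \subset inner S a b \/ Y \subset outer S a b.
Proof.
move=> [DS _ dis] TD aT bT ab Tout YD.
have [YS Y3] := DS Y YD; have [TS T3] := DS T TD.
have [inY|] := boolP (Y \subset inner S a b); first by left.
have [outY|] := boolP (Y \subset outer S a b); first by right.
move=> /subsetPn[c cY cout] /subsetPn[d dY din]; exfalso.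
have cS := fintype.subsetP YS c cY; have dS := fintype.subsetP YS d dY.
move: cout din; rewrite !inE cS dS /= negbK => /andP[ac cb] din.
have [e [eT ea eb]] := card_ge3_ex a b T3.
have cd : c != d by apply: contraNneq din => <-; rewrite (ltnW ac) (ltnW cb).
have [f [fY fc fd]] := card_ge3_ex c d Y3.
have ab' : a != b by rewrite -val_eqE /= ltn_eqF.
have TY : T = Y.
  apply: dis => //.
  apply: (@crossing_interiors _ _ _ (p a) (p b) (p e) (p c) (p d) (p f));
    try exact: convex_set_hull; try exact: mem_hull; try exact: orient_neq0.
    rewrite nmulr_rlt0 ?orient_inside // orient_outside //; move: din; clear; lia.
  have [da|bd] : (d < a)%N \/ (b < d)%N by move: din; clear; lia.
    rewrite orientN (orientN (p d)) mulrNN.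
    rewrite nmulr_rlt0; last exact: orient_inside.
    by apply: orient_outside; rewrite ?cb ?orbT //; exact: ltn_trans ac.
  rewrite pmulr_rlt0; first exact: orient_inside.
  by apply: orient_outside; rewrite ?ac //; exact: ltn_trans bd.
have := fintype.subsetP Tout c; rewrite TY => /(_ cY).
by rewrite inE cS ac cb.
Qed.

Lemma inner_le0 S a b : (a < b)%N -> forall k, k \in inner S a b ->
  orient (p a) (p b) (p k) <= 0.
Proof. by move=> ab k; rewrite inE => /and3P[_ ak kb]; exact: orient_le0. Qed.

Lemma outer_ge0 S a b : (a < b)%N -> forall k, k \in outer S a b ->
  0 <= orient (p a) (p b) (p k).
Proof. by move=> ab k; rewrite inE => /andP[_]; exact: orient_ge0. Qed.

(** The line ab separates the interiors of pieces from different sides, and [hull_cut] gives the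
    covering. *)
Lemma subdivides_glue S D1 D2 a b : (2 < #|S|)%N -> a \in S -> b \in S ->
  (a < b)%N -> subdivides (inner S a b) D1 -> subdivides (outer S a b) D2 ->
  subdivides S (D1 :|: D2)%SET.
Proof.
move=> S3 aS bS ab [DS1 cov1 dis1] [DS2 cov2 dis2].
have m3 : (2 < m)%N by apply: leq_trans S3 _; rewrite -[m in (_ <= m)%N]card_ord max_card.
have pab : p a != p b by apply: vertex_neq => //; rewrite -val_eqE /= ltn_eqF.
have apart Y Z : Y \in D1 -> Z \in D2 ->
    ~ exists x, (hull Y)°%classic x /\ (hull Z)°%classic x.
  move=> /DS1[YS _] /DS2[ZS _] [x [Yx Zx]].
  have : orient (p a) (p b) x < 0.
    apply: interior_halfplane Yx => // y Yy; apply: hull_le0 Yy => k kY.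
    exact: inner_le0 ab _ (fintype.subsetP YS k kY).
  rewrite ltNge => /negP; apply; apply: hull_ge0 (interior_subset Zx) => k kZ.
  exact: outer_ge0 ab _ (fintype.subsetP ZS k kZ).
split=> [Y|_ x Sx|Y Z]; rewrite ?inE.
- case/orP=> [/DS1[YS Y3]|/DS2[YS Y3]]; split=> //.
    exact: fintype.subset_trans YS (inner_sub _ _ _).
  exact: fintype.subset_trans YS (outer_sub _ _ _).
- case: (hull_cut S3 aS bS ab Sx) => -[H3 Hx].
    by have [Y YD Yx] := cov1 H3 x Hx; exists Y; rewrite ?inE ?YD.
  by have [Y YD Yx] := cov2 H3 x Hx; exists Y; rewrite ?inE ?YD ?orbT.
- case/orP=> [YD1|YD2]; case/orP=> [ZD1|ZD2] H.
  + exact: dis1.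
  + by case: (apart _ _ YD1 ZD2 H).
  + by case: H => x [Yx Zx]; case: (apart _ _ ZD1 YD2); exists x.
  + exact: dis2.
Qed.

(* Push x slightly towards z, off the cutting line: only the pieces of S1
   reach there, and as hulls are closed one of them contains x. *)
Lemma subdivides_cover S D S1 S2 u v z : subdivides S D -> S1 \subset S ->
  (2 < #|S1|)%N ->
  (forall k, k \in S1 -> 0 <= orient u v (p k)) ->
  (forall k, k \in S2 -> orient u v (p k) <= 0) ->
  z \in S1 -> 0 < orient u v (p z) ->
  (forall Y, Y \in D -> Y \subset S1 \/ Y \subset S2) ->
  forall x, hull S1 x -> exists2 Y, Y \in [set Y in D | Y \subset S1]%SET & hull Y x.
Proof.
move=> [DS cov _] S1S S13 ge le zS1 oz split_D x S1x.
have S3 : (2 < #|S|)%N := leq_trans S13 (subset_leq_card S1S).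
apply: contrapT => none.
have out Y : Y \in enum [set Y in D | Y \subset S1]%SET ->
    eventually0 (fun e : R => ~ hull Y (x + e *: (p z - x))).
  rewrite mem_enum => YD; have Yx : ~ hull Y x by move=> Yx; apply: none; exists Y.
  have Y3 : (2 < #|Y|)%N by move: YD; rewrite inE => /andP[/DS[]].
  (* Closedness enters in this form: a point outside the hull violates one of the half-plane
     conditions of [hull_edges], and a strict violation persists for small displacements. *)
  have far w t : (forall y, hull Y y -> 0 <= orient w t y) -> orient w t x < 0 ->
      eventually0 (fun e : R => ~ hull Y (x + e *: (p z - x))).
    move=> H; rewrite -oppr_gt0.
    move=> /(eventually0_affine_gt0 (- (orient w t (p z) - orient w t x))).
    apply: eventually0_mono => e e0 + /H; rewrite orient_shift => H1 H2.
    by move: H1; rewrite mulrN -opprD oppr_gt0 ltNge H2.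
  apply: contrapT => nev; apply: Yx; apply: hull_edges => // i j iY jY.
    move=> ij H; rewrite leNgt; apply/negP => /far; apply: contra_not nev; apply.
    by move=> y Yy; exact: hull_edge_ge0 Yy ij H.
  move=> H; rewrite leNgt; apply/negP; rewrite -oppr_lt0 -orientN => /far.
  apply: contra_not nev; apply=> y Yy; rewrite orientN oppr_ge0.
  exact: hull_long_le0 Yy H.
have [e e0 [He e1]] := eventually0_ex (eventually0_and (eventually0_seq out) (eventually0_lt ltr01)).
pose y := x + e *: (p z - x).
have yE : y = e *: p z + (1 - e) *: x.
  by rewrite /y scalerBr scalerBl scale1r; apply: plane_eq; rewrite !mxE; ring.
have S1y : hull S1 y.
  rewrite yE; apply: (convex_setP _).1 => //; [exact: convex_set_hull|exact: mem_hull|].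
  by rewrite !ltW.
have [Y YD Yy] := cov S3 y (hullS S1S S1y).
case: (split_D Y YD) => YS.
  by apply: (He Y) => //; rewrite mem_enum inE YD.
have : orient u v y <= 0 by apply: hull_le0 Yy => k /(fintype.subsetP YS); exact: le.
apply/negP; rewrite -ltNge yE orient_conv.
have ox : 0 <= orient u v x by apply: hull_ge0 S1x.
by rewrite ltr_pwDl ?mulr_gt0 // mulr_ge0 // subr_ge0 ltW.
Qed.

Lemma subdivides_inner S D a b : subdivides S D -> a \in S -> b \in S ->
  (a < b)%N -> (forall Y, Y \in D -> Y \subset inner S a b \/ Y \subset outer S a b) ->
  subdivides (inner S a b) [set Y in D | Y \subset inner S a b]%SET.
Proof.
move=> sD aS bS ab H; case: (sD) => DS _ dis; split=> [Y|in3|Y Z].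
- by rewrite inE => /andP[/DS[]].
- have [z [zS za zb]] := card_ge3_ex a b in3.
  apply: (@subdivides_cover S D _ (outer S a b) (p b) (p a) z) => //.
  + exact: inner_sub.
  + by move=> k kS; rewrite orientN oppr_ge0; exact: inner_le0 kS.
  + by move=> k kS; rewrite orientN oppr_le0; exact: outer_ge0 kS.
  move: zS; rewrite inE => /andP[_ zab].
  have /andP[] := ord_strictly_between zab za zb.
  by rewrite orientN oppr_gt0; exact: orient_inside.
- by rewrite !inE => /andP[YD _] /andP[ZD _]; exact: dis.
Qed.

Lemma subdivides_outer S D a b : subdivides S D -> a \in S -> b \in S ->
  (a < b)%N -> (forall Y, Y \in D -> Y \subset inner S a b \/ Y \subset outer S a b) ->
  subdivides (outer S a b) [set Y in D | Y \subset outer S a b]%SET.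
Proof.
move=> sD aS bS ab H; case: (sD) => DS _ dis; split=> [Y|out3|Y Z].
- by rewrite inE => /andP[/DS[]].
- have [z [zS za zb]] := card_ge3_ex a b out3.
  apply: (@subdivides_cover S D _ (inner S a b) (p a) (p b) z) => //.
  + exact: outer_sub.
  + by move=> k kS; exact: outer_ge0 kS.
  + by move=> k kS; exact: inner_le0 kS.
  + apply: orient_outside => //; move: zS za zb; rewrite inE -!val_eqE /=; clear; lia.
  + by move=> Y /H[]; [right|left].
- by rewrite !inE => /andP[YD _] /andP[ZD _]; exact: dis.
Qed.

End Subdivisions.

(** * Weighted enumeration of subdivisions *)

Lemma sum_rank m (K : nmodType) (U : {set 'I_m}) (G : nat -> K) :
  \sum_(b in U) G #|[set k in U | (k <= b)%N]%SET| = \sum_(l < #|U|) G l.+1.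
Proof.
move cU: #|U| => n; elim: n U cU => [|n IH] U cU.
  by rewrite big_ord0 big1 // => b; rewrite (cards0_eq cU) inE.
have [|c cU' cmax] := @set_max _ U; first by rewrite -card_gt0 cU.
rewrite (big_setD1 c) //= big_ord_recr /= addrC; congr (_ + _); last first.
  rewrite -cU; congr (G _); apply: eq_card => k; rewrite inE.
  by case kU: (k \in U) => //=; exact: cmax.
have cD : #|U :\ c| = n by move: cU; rewrite (cardsD1 c) cU' add1n => -[].
rewrite -(IH _ cD); apply: eq_bigr => b; rewrite !inE => /andP[bc bU].
congr (G _); apply: eq_card => k; rewrite !inE.
have [->|//] := eqVneq k c; rewrite /= cU' /=; apply/negbTE; rewrite -ltnNge.
by rewrite ltn_neqAle cmax // andbT.
Qed.

Section Counting.
Variables (R : realType) (m : nat) (p : 'I_m -> 'rV[R]_2).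
Hypothesis p_ccw : ccw p.
Variables (K : comNzRingType) (w : nat -> K).
Implicit Types (S T Y Z : {set 'I_m}) (D : {set {set 'I_m}}) (a b c k : 'I_m).

Definition subdivision_sum S : K :=
  \sum_(D : {set {set 'I_m}} | `[< subdivides p S D >]) \prod_(Y in D) w #|Y|.

(* For c the last vertex of S, rooted S a c D means that the piece of D on the
   edge joining the first and last vertices of S has all the vertices of S up
   to a. *)
Definition corner S a c := [set k in S | (k <= a)%N || (c <= k)%N]%SET.

Definition rooted S a c D := [exists T in D, corner S a c \subset T].

Definition rooted_sum S a c : K :=
  \sum_(D : {set {set 'I_m}} | `[< subdivides p S D >] && rooted S a c D)
    \prod_(Y in D) w #|Y|.

Lemma card_inner_outer S a b : (a < b)%N -> (#|inner S a b :&: outer S a b| <= 2)%N.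
Proof.
move=> ab; apply: leq_trans (_ : (#|[set a; b]%SET| <= 2)%N); last by rewrite cards2; case: (_ != _).
apply: subset_leq_card; apply/fintype.subsetP => k; rewrite !inE -!val_eqE /=.
by move: ab; clear; case: (k \in S) => //=; lia.
Qed.

(** The bijection behind one step of the exploration: on the right, the root piece [T] contains all
    vertices up to a, then b, and nothing strictly between them. Cutting along ab loses nothing
    because no piece crosses ab and none lies on both sides. *)
Lemma subdivides_cut S a b c D1 D2 : a \in S -> b \in S -> c \in S ->
  (a < b)%N -> (b <= c)%N ->
  let D := (D1 :|: D2)%SET in
  [/\ subdivides p (inner S a b) D1, subdivides p (outer S a b) D2
    & rooted (outer S a b) b c D2] <->
  [/\ subdivides p S D,
      exists2 T, T \in D & (corner (outer S a b) b c \subset T) && (T \subset outer S a b),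
      [set Y in D | Y \subset inner S a b]%SET = D1 &
      [set Y in D | Y \subset outer S a b]%SET = D2].
Proof.
move=> aS bS cS ab bc D; have aN : (#|inner S a b :&: outer S a b| <= 2)%N by exact: card_inner_outer.
split=> [[s1 s2 /exists_inP[T TD Tc]]|[sD [T TD /andP[Tc To]] e1 e2]].
  have [H1 _ _] := s1; have [H2 _ _] := s2.
  have [To T3] := H2 T TD.
  have S3 : (2 < #|S|)%N.
    by apply: leq_trans T3 (subset_leq_card _); exact: fintype.subset_trans To (outer_sub _ _ _).
  split.
  - exact: subdivides_glue s1 s2.
  - by exists T; rewrite ?inE ?TD ?orbT // Tc.
  - apply/setP => Y; rewrite !inE; apply/andP/idP => [[/orP[//|/H2[Yo Y3]] Yi]|YD].
      have : Y \subset inner S a b :&: outer S a b by rewrite finset.subsetI Yi.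
      by move=> /subset_leq_card Y2; have := leq_trans Y3 (leq_trans Y2 aN).
    by rewrite YD; have [] := H1 Y YD.
  - apply/setP => Y; rewrite !inE; apply/andP/idP => [[/orP[/H1[Yi Y3]|//] Yo]|YD].
      have : Y \subset inner S a b :&: outer S a b by rewrite finset.subsetI Yi.
      by move=> /subset_leq_card Y2; have := leq_trans Y3 (leq_trans Y2 aN).
    by rewrite YD orbT; have [] := H2 Y YD.
have aT : a \in T.
  by apply: (fintype.subsetP Tc); rewrite !inE aS ltnn /= (ltnW ab).
have bT : b \in T.
  by apply: (fintype.subsetP Tc); rewrite !inE bS ltnn andbF leqnn.
have uncrossed Y : Y \in D -> Y \subset inner S a b \/ Y \subset outer S a b.
  exact: subdivides_uncrossed sD TD aT bT ab To.
split.
- by rewrite -e1; apply: subdivides_inner.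
- by rewrite -[X in subdivides _ _ X]e2; apply: subdivides_outer.
- by apply/exists_inP; exists T => //; rewrite -e2 inE TD.
Qed.

Lemma rooted_sum_cut S a b c : a \in S -> b \in S -> c \in S ->
  (a < b)%N -> (b <= c)%N ->
  \sum_(D : {set {set 'I_m}} | `[< subdivides p S D >] &&
     [exists T in D, (corner (outer S a b) b c \subset T) && (T \subset outer S a b)])
    \prod_(Y in D) w #|Y|
  = subdivision_sum (inner S a b) * rooted_sum (outer S a b) b c.
Proof.
move=> aS bS cS ab bc.
rewrite /subdivision_sum /rooted_sum big_distrlr /= pair_big /=.
pose h (q : {set {set 'I_m}} * {set {set 'I_m}}) := (q.1 :|: q.2)%SET.
pose h' D := ([set Y in D | Y \subset inner S a b]%SET,
              [set Y in D | Y \subset outer S a b]%SET).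
rewrite (reindex_onto h h') /=; last first.
  move=> D /andP[/asboolP sD /exists_inP[T TD /andP[Tc To]]].
  have aT : a \in T by apply: (fintype.subsetP Tc); rewrite !inE aS ltnn /= (ltnW ab).
  have bT : b \in T by apply: (fintype.subsetP Tc); rewrite !inE bS ltnn andbF leqnn.
  apply/setP => Y; rewrite !inE -andb_orr; case YD: (Y \in D) => //=.
  by apply/orP; exact: subdivides_uncrossed sD TD aT bT ab To YD.
apply: eq_big => [[D1 D2]|[D1 D2] H] /=.
  apply/idP/idP.
    move=> /andP[/andP[/asboolP sD /exists_inP ex] /eqP[e1 e2]].
    have [s1 s2 r2] := (@subdivides_cut S a b c D1 D2 aS bS cS ab bc).2 (And4 sD ex e1 e2).
    by rewrite r2 andbT; apply/andP; split; exact/asboolP.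
  move=> /andP[/asboolP s1 /andP[/asboolP s2 r2]].
  have [sD ex e1 e2] := (@subdivides_cut S a b c D1 D2 aS bS cS ab bc).1 (And3 s1 s2 r2).
  by rewrite /h' /h /= e1 e2 eqxx andbT; apply/andP; split; [exact/asboolP|exact/exists_inP].
rewrite /h /= (eq_bigl [predU D1 & D2]) => [|Y]; last by rewrite !inE.
rewrite bigU //=; move: H => /andP[/andP[/asboolP sD _] /eqP[e1 e2]].
apply/pred0P => Y /=; apply/negbTE/negP => /andP[YD1 YD2]; have [H _ _] := sD.
have [_ Y3] : Y \subset S /\ (2 < #|Y|)%N by apply: H; rewrite inE YD1.
have Yi : Y \subset inner S a b by move: YD1; rewrite -e1 inE => /andP[].
have Yo : Y \subset outer S a b by move: YD2; rewrite -e2 inE => /andP[].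
have : Y \subset inner S a b :&: outer S a b by rewrite finset.subsetI Yi.
by move=> /subset_leq_card Y2; have := leq_trans Y3 (leq_trans Y2 (card_inner_outer _ ab)).
Qed.

(* The element b is the vertex following a on the root polygon. *)
Lemma rooted_sum_step S a c : a \in S -> c \in S -> (a < c)%N ->
  (forall k, k \in S -> (k <= c)%N) ->
  rooted_sum S a c = \sum_(b in S | (a < b)%N)
    subdivision_sum (inner S a b) * rooted_sum (outer S a b) b c.
Proof.
move=> aS cS ac cmax.
have [s sS smin] : exists2 s, s \in S & forall k, k \in S -> (s <= k)%N.
  by apply: set_min; apply/set0Pn; exists a.
pose cond b D := [exists T in D, (corner (outer S a b) b c \subset T)
                                  && (T \subset outer S a b)].
(* All these conditions speak of the root piece, which is unique, and b is its first vertex after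
   a. *)
have cond_inj D b b' : subdivides p S D -> b \in S -> b' \in S -> (a < b)%N -> (a < b')%N ->
    cond b D -> cond b' D -> b = b'.
  move=> sD bS bS' ab ab' /exists_inP[T TD /andP[Tc To]] /exists_inP[T' TD' /andP[Tc' To']].
  have ends d (U : {set 'I_m}) : d \in S -> (a < d)%N -> corner (outer S a d) d c \subset U ->
      s \in U /\ c \in U.
    move=> dS ad Uc; have sa := smin a aS; have dc := cmax d dS.
    split; apply: (fintype.subsetP Uc); rewrite !inE ?sS ?cS /=; move: sa ad dc; clear; lia.
  have [sT cT] := ends b T bS ab Tc; have [sT' cT'] := ends b' T' bS' ab' Tc'.
  have TT : T = T'.
    apply: (subdivides_root_uniq p_ccw sD _ TD TD' sT cT sT' cT').
    by move=> k kS; rewrite smin ?cmax.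
  have bT : b \in T.
    by apply: (fintype.subsetP Tc); rewrite !inE bS ltnn andbF leqnn.
  have bT' : b' \in T'.
    by apply: (fintype.subsetP Tc'); rewrite !inE bS' ltnn andbF leqnn.
  have := fintype.subsetP To b'; have := fintype.subsetP To' b.
  rewrite -TT in bT' *; rewrite bT bT' !inE bS bS' ab ab' /= -!leqNgt.
  by move=> /(_ isT) b1 /(_ isT) b2; apply: val_inj; apply: anti_leq; rewrite b1 b2.
have cond_ex D : subdivides p S D -> rooted S a c D ->
    exists b, [&& b \in S, (a < b)%N & cond b D].
  move=> [DS _ _] /exists_inP[T TD Tc]; have [TS _] := DS T TD.
  have cT : c \in T by apply: (fintype.subsetP Tc); rewrite inE cS leqnn orbT.
  have [b bT [/andP[ab bc] bnext]] := set_next cT ac.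
  exists b; rewrite (fintype.subsetP TS b bT) ab; apply/exists_inP; exists T => //.
  apply/andP; split; apply/fintype.subsetP => k.
    rewrite !inE => /andP[/andP[kS kab] kbc].
    have [kb|kb] := eqVneq k b; first by rewrite kb.
    apply: (fintype.subsetP Tc); rewrite inE kS /=.
    by move: kab kbc kb; rewrite -val_eqE /=; clear; lia.
  by move=> kT; rewrite inE (fintype.subsetP TS k kT) bnext.
have cond_rooted D b : b \in S -> (a < b)%N -> cond b D -> rooted S a c D.
  move=> bS ab /exists_inP[T TD /andP[Tc To]]; apply/exists_inP; exists T => //.
  apply: fintype.subset_trans Tc; apply/fintype.subsetP => k; rewrite !inE.
  move=> /andP[kS kac]; rewrite kS /=; have := cmax b bS; move: kac ab; clear; lia.
pose next D := odflt a [pick b | [&& b \in S, (a < b)%N & cond b D]].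
rewrite {1}/rooted_sum (partition_big next (fun b => (b \in S) && (a < b)%N)) /=.
  apply: eq_bigr => b /andP[bS ab]; rewrite -rooted_sum_cut ?cmax //.
  apply: eq_bigl => D; rewrite -/(cond b D) -andbA; case: asboolP => //= sD.
  apply/andP/idP => [[rD]|cD].
    rewrite /next; case: pickP => [b' /and3P[bS' ab' cD] /= /eqP <- //|none].
    by have [b' H] := cond_ex D sD rD; rewrite none in H.
  split; first exact: cond_rooted cD.
  rewrite /next; case: pickP => [b' /and3P[bS' ab' cD'] /=|/(_ b)].
    by rewrite (cond_inj D b b').
  by rewrite bS ab cD.
move=> D /andP[/asboolP sD rD]; rewrite /next; case: pickP => [b /and3P[-> ->]//|none].
by have [b' H] := cond_ex D sD rD; rewrite none in H.
Qed.

Lemma subdivision_sum_small S : (#|S| <= 2)%N -> subdivision_sum S = 1.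
Proof.
move=> S2; rewrite /subdivision_sum (big_pred1 finset.set0) ?big_set0 // => D.
by apply/asboolP/eqP => /(subdivides_small p D S2).
Qed.

Lemma rooted_sum_small S a c : (#|S| <= 2)%N -> rooted_sum S a c = 0.
Proof.
move=> S2; apply: big1 => D /andP[/asboolP/(subdivides_small p D S2) ->].
by move=> /exists_inP[T]; rewrite inE.
Qed.

Lemma rooted_sum_end S a : a \in S -> (forall k, k \in S -> (k <= a)%N) ->
  (2 < #|S|)%N -> rooted_sum S a a = w #|S|.
Proof.
move=> aS amax S3; rewrite /rooted_sum (big_pred1 [set S]%SET) ?big_set1 // => D.
apply/andP/eqP => [[/asboolP sD /exists_inP[T TD Tc]]|->]; last first.
  split; first exact/asboolP/subdivides1.
  apply/exists_inP; exists S; rewrite ?inE //.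
  by apply/fintype.subsetP => k; rewrite inE => /andP[].
have [DS _ _] := sD.
have TS : T = S.
  apply/eqP; rewrite finset.eqEsubset (DS T TD).1 /=.
  apply: fintype.subset_trans Tc; apply/fintype.subsetP => k kS.
  by rewrite inE kS amax.
apply/setP => Y; rewrite inE; apply/idP/eqP => [YD|->]; last by rewrite -TS.
have [YS Y3] := DS Y YD.
by rewrite -TS; apply: (subdivides_disjoint p_ccw sD YD TD _ _ Y3); rewrite ?TS.
Qed.

Lemma subdivision_sum_rooted S a c : a \in S -> c \in S ->
  (forall k, k \in S -> (a <= k)%N && (k <= c)%N) -> (2 < #|S|)%N ->
  subdivision_sum S = rooted_sum S a c.
Proof.
move=> aS cS ac S3; apply: eq_bigl => D; case: asboolP => //= sD; apply/esym.
have [T [TD aT cT]] := subdivides_root p_ccw sD S3 aS cS ac.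
apply/exists_inP; exists T => //; apply/fintype.subsetP => k.
rewrite inE => /andP[kS kac]; have /andP[ak kc] := ac k kS.
case/orP: kac => [ka|ck].
  by rewrite (_ : k = a) //; apply: val_inj; apply: anti_leq; rewrite ka.
by rewrite (_ : k = c) //; apply: val_inj; apply: anti_leq; rewrite kc.
Qed.

Variable beta : nat -> K.
Hypotheses (beta0 : beta 0%N = 0) (beta1 : beta 1%N = 1).
Hypothesis betaE : forall n, beta n.+2 =
  \sum_(k < n.+1) w k.+3 * fps_exp beta k.+2 n.+2.

(** A root polygon that has closed up with fewer than three vertices is not a piece and gets weight
    0, in agreement with [rooted_sum_small]. *)
Let w3 (q : nat) := if (2 < q)%N then w q else 0.

(* The coefficient of x^r in sum_i w3(j + i) beta(x)^i. *)
Let root_coef j r := \sum_(i < r.+1) w3 (j + i)%N * fps_exp beta i r.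

(** One factor beta is split off every positive power; the power 0 contributes nothing in positive
    degree. *)
Lemma root_coefS j r : root_coef j r.+1 =
  \sum_(l < r.+1) beta l.+1 * root_coef j.+1 (r - l)%N.
Proof.
rewrite /root_coef big_ord_recl {1}/fps_exp /= /fps_one /= mulr0 add0r.
have E l : (l < r.+1)%N -> \sum_(i < (r - l).+1) w3 (j.+1 + i)%N * fps_exp beta i (r - l)%N =
    \sum_(i < r.+1) w3 (j.+1 + i)%N * fps_exp beta i (r - l)%N.
  move=> lr; have le : ((r - l).+1 <= r.+1)%N by rewrite ltnS leq_subr.
  rewrite (big_ord_widen _ (fun i => w3 (j.+1 + i)%N * fps_exp beta i (r - l)%N) le).
  rewrite big_mkcond; apply: eq_bigr => i _; case: ltnP => // il.
  by rewrite fps_exp0 ?mulr0.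
under [RHS]eq_bigr => l _ do rewrite (E _ (ltn_ord l)) mulr_sumr.
rewrite exchange_big /=; apply: eq_bigr => i _.
rewrite /bump /= add1n addSnnS fps_expS big_ord_recl beta0 mul0r add0r mulr_sumr.
by apply: eq_bigr => l _; rewrite /bump /= ?add1n ?subSS mulrCA.
Qed.

(** Here j vertices of the root piece are fixed and r vertices of S remain. If b is the l-th of
    these, the polygon behind ab has l+1 vertices and contributes [beta l], leaving j+1 fixed and
    r-l remaining, which is the recursion [root_coefS]. *)
Lemma rooted_sumE N :
  (forall S, (1 < #|S|)%N -> (#|S| < N)%N -> subdivision_sum S = beta #|S|.-1) ->
  forall r S a c, (#|S| <= N)%N -> a \in S -> c \in S ->
  (forall k, k \in S -> (k <= c)%N) -> #|[set k in S | (a < k)%N]%SET| = r ->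
  rooted_sum S a c = root_coef #|[set k in S | (k <= a)%N]%SET| r.
Proof.
move=> IHN; elim/ltn_ind => -[|r] IHr S a c SN aS cS cmax cr.
  have amax k : k \in S -> (k <= a)%N.
    move=> kS; rewrite leqNgt; apply/negP => ak.
    by have := cards0_eq cr; move/setP/(_ k); rewrite !inE kS ak.
  have <- : a = c by apply: val_inj; apply: anti_leq; rewrite cmax ?amax.
  rewrite /root_coef big_ord1 addn0 mulr1 (_ : [set k in S | _]%SET = S).
    rewrite /w3; case: ltnP => S3; first exact: rooted_sum_end.
    exact: rooted_sum_small.
  by apply/setP => k; rewrite inE; case kS: (k \in S) => //=; exact: amax.
have /card_gt0P[a' ] : (0 < #|[set k in S | (a < k)%N]%SET|)%N by rewrite cr.
rewrite inE => /andP[aS' aa'].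
have ac : (a < c)%N := leq_trans aa' (cmax a' aS').
rewrite rooted_sum_step // root_coefS; set j := #|_|.
pose U := [set k in S | (a < k)%N]%SET.
pose G l := beta l * root_coef j.+1 (r.+1 - l)%N.
rewrite [RHS](_ : _ = \sum_(l < #|U|) G l.+1); last first.
  by rewrite /U cr; apply: eq_bigr => l _; rewrite /G subSS.
(* Summing over the next vertex b is summing over its rank l among the vertices after a. *)
rewrite -(sum_rank U G).
rewrite (eq_bigl (fun b => b \in U)) => [|b]; last by rewrite [in RHS]inE.
apply: eq_bigr => b; rewrite inE => /andP[bS ab].
set l := #|_|; pose V := [set k in S | (b < k)%N]%SET.
have UE : (l + #|V|)%N = r.+1.
  rewrite -cr -(cardsID [set k in U | (k <= b)%N]%SET U); congr (_ + _)%N; apply: eq_card => k; rewrite !inE.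
    by case: (k \in S) => //=; case: (a < k)%N.
  by case: (k \in S) => //=; move: ab; clear; lia.
have SE : (j + r.+1)%N = #|S|.
  rewrite -cr -(cardsID [set k in S | (k <= a)%N]%SET S); congr (_ + _)%N; apply: eq_card => k; rewrite !inE.
    by case: (k \in S).
  by case: (k \in S) => //=; rewrite -ltnNge andbT.
have l_gt0 : (0 < l)%N.
  by apply/card_gt0P; exists b; rewrite !inE bS ab leqnn.
have innerE : #|inner S a b| = l.+1.
  rewrite (cardsD1 a) inE aS leqnn (ltnW ab) /= add1n; congr _.+1.
  by apply: eq_card => k; rewrite !inE -val_eqE /=; case: (k \in S) => //=; rewrite ?andbF //; move: ab; clear; lia.
have prefE : #|[set k in outer S a b | (k <= b)%N]%SET| = j.+1.
  rewrite (cardsD1 b) !inE bS leqnn ltnn andbF /= add1n; congr _.+1.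
  by apply: eq_card => k; rewrite !inE -val_eqE /=; case: (k \in S) => //=; rewrite ?andbF //; move: ab; clear; lia.
have suffE : #|[set k in outer S a b | (b < k)%N]%SET| = (r.+1 - l)%N.
  rewrite -UE addKn; apply: eq_card => k; rewrite !inE; case: (k \in S) => //=.
  by move: ab; clear; lia.
have j_gt0 : (0 < j)%N by apply/card_gt0P; exists a; rewrite inE aS leqnn.
have outer_step : rooted_sum (outer S a b) b c = root_coef j.+1 (r.+1 - l)%N.
  rewrite -prefE; apply: IHr => //.
  - by move: l_gt0 UE; clear; lia.
  - by apply: leq_trans SN; exact: subset_leq_card (outer_sub _ _ _).
  - by rewrite inE bS ltnn andbF.
  - by rewrite inE cS ac /= -leqNgt cmax.
  - by move=> k; rewrite inE => /andP[kS _]; exact: cmax.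
rewrite outer_step; have [in_lt|in_ge] := ltnP #|inner S a b| #|S|.
  congr (_ * _); rewrite IHN ?innerE //=.
  by rewrite -innerE; exact: leq_trans in_lt SN.
(* The polygon behind ab is all of S only when a is the first vertex and b the last. The induction
   hypothesis does not cover it, but the root piece would then be the bare edge ab, whose weight
   [w3 2] is 0. *)
suff E : root_coef j.+1 (r.+1 - l)%N = 0 by rewrite /G E !mulr0.
have [-> ->] : j = 1%N /\ (r.+1 - l = 0)%N.
  by move: in_ge; rewrite innerE -SE; move: UE j_gt0; clear; lia.
by rewrite /root_coef big_ord1 mul0r.
Qed.

Theorem subdivision_sumE S : (1 < #|S|)%N -> subdivision_sum S = beta #|S|.-1.
Proof.
move cS: #|S| => N; elim/ltn_ind: N S cS => N IH S cS N1.
have [N2|N3] := leqP N 2.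
  rewrite subdivision_sum_small ?cS //.
  by rewrite (_ : N = 2%N) //; move: N1 N2; clear; lia.
have S0 : S != finset.set0 by rewrite -card_gt0 cS ltnW // ltnW.
have [a aS amin] := set_min S0; have [c cS' cmax] := set_max S0.
rewrite (@subdivision_sum_rooted S a c) ?cS // => [|k kS]; last by rewrite amin ?cmax.
have prefE : #|[set k in S | (k <= a)%N]%SET| = 1%N.
  rewrite (_ : [set k in S | _]%SET = [set a]%SET) ?cards1 //.
  apply/setP => k; rewrite !inE; apply/andP/eqP => [[kS ka]|->]; last by rewrite aS leqnn.
  by apply: val_inj; apply: anti_leq; rewrite ka amin.
have suffE : #|[set k in S | (a < k)%N]%SET| = N.-1.
  have := cardsID [set k in S | (k <= a)%N]%SET S.
  rewrite cS (_ : S :&: _ = [set k in S | (k <= a)%N]%SET) ?prefE; last first.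
    by apply/setP => k; rewrite !inE; case: (k \in S).
  move=> <-; rewrite add1n /=; apply: eq_card => k; rewrite !inE.
  by case: (k \in S) => //=; rewrite -ltnNge andbT.
rewrite (@rooted_sumE N _ N.-1 S a c) ?cS // => [|T T1 TN]; last exact: (IH #|T|).
rewrite prefE; case: N N3 {IH cS N1 suffE} => [|[|[|n]]] // _ /=.
(* The terms for exponents 0 and 1 carry the weights [w3 1] and [w3 2], both zero; what remains is
   the recursion for [beta]. *)
rewrite betaE /root_coef 2!big_ord_recl /= /w3 /= !mul0r !add0r.
by apply: eq_bigr => i _; rewrite /bump /= !add1n.
Qed.

End Counting.

(** * Matryoshkas as families of vertex sets, and their recursion *)

Section Matryoshkas.
Variables (R : realType) (m : nat) (p : 'I_m -> 'rV[R]_2).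
Hypothesis p_ccw : ccw p.
Implicit Types (S X Y Z : {set 'I_m}) (D M : {set {set 'I_m}}).

(* Matryoshkas are encoded by the vertex sets of their polygons. *)
Definition children M X :=
  [set Y in M | (Y \proper X) && [forall Z in M, (Z \proper X) ==> ~~ (Y \proper Z)]]%SET.

Definition nonminimal M := [set X in M | [exists Y in M, Y \proper X]]%SET.

Definition nested S M : Prop :=
  [/\ forall Y, Y \in M -> Y \subset S /\ (2 < #|Y|)%N, S \in M
    & forall X, X \in nonminimal M -> subdivides p X (children M X)].

Definition below M Y := [set Z in M | Z \subset Y]%SET.

Lemma nonminimal_below M Y : nonminimal (below M Y) = below (nonminimal M) Y.
Proof.
apply/setP => X; rewrite !inE; apply/idP/idP.
  move=> /andP[/andP[XM XY] /exists_inP[Z]]; rewrite inE => /andP[ZM ZY] ZX.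
  by rewrite XM XY andbT; apply/exists_inP; exists Z.
move=> /andP[/andP[XM /exists_inP[Z ZM ZX]] XY]; rewrite XM XY /=.
apply/exists_inP; exists Z => //; rewrite inE ZM /=.
exact: fintype.subset_trans (proper_sub ZX) XY.
Qed.

Lemma children_below M X Y : X \subset Y -> children (below M Y) X = children M X.
Proof.
move=> XY; apply/setP => Z; rewrite !inE.
have sub (W : {set 'I_m}) : W \proper X -> W \subset Y.
  by move=> WX; exact: fintype.subset_trans (proper_sub WX) XY.
case ZX: (Z \proper X); rewrite ?andbF // (sub Z ZX) andbT /=; congr (_ && _).
apply/forall_inP/forall_inP => H W; last by rewrite inE => /andP[WM _]; exact: H.
by move=> WM; apply/implyP => WX; apply: (implyP (H W _)) => //; rewrite inE WM sub.
Qed.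

Lemma children_cover M X Z : Z \in M -> Z \proper X ->
  exists2 Y, Y \in children M X & Z \subset Y.
Proof.
move=> ZM ZX; pose P Y := [&& Y \in M, Y \proper X & Z \subset Y].
have PZ : P Z by rewrite /P ZM ZX fintype.subxx.
have [Y /and3P[YM YX ZY] Ymax] := arg_maxnP (fun Y => #|Y|) PZ.
exists Y => //; rewrite inE YM YX; apply/forall_inP => W WM; apply/implyP => WX.
apply/negP => YW; have /= := Ymax W; rewrite /P WM WX.
rewrite (fintype.subset_trans ZY (proper_sub YW)) => /(_ isT).
by rewrite leqNgt (proper_card YW).
Qed.

Lemma subdivides_neq0 S D : (2 < #|S|)%N -> subdivides p S D -> exists Y, Y \in D.
Proof.
move=> S3 [_ cov _]; have /card_gt0P[k kS] : (0 < #|S|)%N by exact: leq_trans S3.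
by have [Y YD _] := cov S3 (p k) (mem_hull (p := p) kS); exists Y.
Qed.

Lemma subdivides_proper S D Y : subdivides p S D -> S \notin D -> Y \in D -> Y \proper S.
Proof.
move=> [DS _ _] SD YD; rewrite finset.properEneq (DS Y YD).1 andbT.
by apply: contraNneq SD => <-.
Qed.

(** Every member other than S lies below a child. Conversely, the pieces of D are the maximal
    members below S, because a piece properly contained in a member below another piece would share
    interior with that piece. *)
Lemma nested_split S D M : (2 < #|S|)%N -> subdivides p S D -> S \notin D ->
  [/\ nested S M, M != [set S]%SET & children M S = D] <->
  [/\ S \in M, forall Z, Z \in M -> Z = S \/ (exists2 Y, Y \in D & Z \subset Y)
    & forall Y, Y \in D -> nested Y (below M Y)].
Proof.
move=> S3 sD SD; split=> [[[MS SM sub] MneS chD]|[SM M_D MY]].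
  split=> // [Z ZM|Y YD].
    have [->|ZS] := eqVneq Z S; [by left|right].
    have ZpS : Z \proper S by rewrite finset.properEneq ZS (MS Z ZM).1.
    by have [Y] := children_cover ZM ZpS; rewrite chD; exists Y.
  have YM : Y \in M by move: YD; rewrite -chD inE => /andP[].
  split=> [Z||X].
  - by rewrite inE => /andP[/MS[_ ZM] ZY].
  - by rewrite inE YM fintype.subxx.
  - rewrite nonminimal_below inE => /andP[Xnm XY].
    by rewrite children_below //; exact: sub.
have DM Y : Y \in D -> Y \in M.
  by move=> /MY[_ + _]; rewrite inE => /andP[].
have pr Y : Y \in D -> Y \proper S := subdivides_proper sD SD.
have chD : children M S = D.
  apply/setP => Z; rewrite inE; apply/idP/idP => [/and3P[ZM ZS /forall_inP Zmax]|ZD].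
    have [ZE|[Y YD ZY]] := M_D Z ZM; first by rewrite ZE fintype.properxx in ZS.
    have := Zmax Y (DM Y YD); rewrite (pr Y YD) /= finset.properEneq ZY andbT negbK.
    by move=> /eqP ->.
  rewrite (DM Z ZD) (pr Z ZD) /=; apply/forall_inP => W WM; apply/implyP => WS.
  apply/negP => ZW; have [WE|[Y YD WY]] := M_D W WM; first by rewrite WE fintype.properxx in WS.
  have [DS _ _] := sD; have [_ Z3] := DS Z ZD.
  have ZY : Z = Y.
    apply: (subdivides_disjoint p_ccw sD ZD YD (fintype.subxx Z) _ Z3).
    exact: fintype.subset_trans (proper_sub ZW) WY.
  by move: ZW; rewrite ZY properE WY andbF.
split=> //; last first.
  apply/eqP => ME; have [Y YD] := subdivides_neq0 S3 sD.
  by have := DM Y YD; rewrite ME inE => /eqP YS; rewrite YS (negPf SD) in YD.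
split=> // [Z ZM|X Xnm].
  have [->//|[Y YD ZY]] := M_D Z ZM; split.
    exact: fintype.subset_trans ZY (proper_sub (pr Y YD)).
  by have [H _ _] := MY Y YD; have [|] := H Z; rewrite ?inE ?ZM.
have XM : X \in M by move: Xnm; rewrite inE => /andP[].
have [->|[Y YD XY]] := M_D X XM; first by rewrite chD.
have [_ _ H] := MY Y YD; rewrite -(children_below M XY); apply: H.
by rewrite nonminimal_below inE Xnm.
Qed.

Variables (K : comNzRingType) (t : K).

Definition nested_sum S : K :=
  \sum_(M : {set {set 'I_m}} | `[< nested S M >]) t ^+ #|nonminimal M|.

(** With [disassemble], this matches Matryoshkas of S having children D with choices of one
    Matryoshka per piece; outside D the chosen family is empty, so that the choice function is
    determined. *)
Definition assemble S (f : {ffun {set 'I_m} -> {set {set 'I_m}}}) :=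
  (S |: \bigcup_Y f Y)%SET.

Definition disassemble D M : {ffun {set 'I_m} -> {set {set 'I_m}}} :=
  [ffun Y => if Y \in D then below M Y else finset.set0].

Lemma below_assemble S D (f : {ffun {set 'I_m} -> {set {set 'I_m}}}) Y :
  (2 < #|S|)%N -> subdivides p S D -> S \notin D ->
  (forall Y, Y \notin D -> f Y = finset.set0) -> (forall Y, Y \in D -> nested Y (f Y)) ->
  Y \in D -> below (assemble S f) Y = f Y.
Proof.
move=> S3 sD SD f0 fD YD; apply/setP => Z; rewrite !inE.
apply/andP/idP => [[/orP[/eqP ->|/bigcupP[W _ ZW]] ZY]|ZY].
- have := subdivides_proper sD SD YD; rewrite properE.
  by rewrite ZY andbF.
- have WD : W \in D by apply: contraLR ZW => /f0 ->; rewrite inE.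
  have [H _ _] := fD W WD; have [ZsW Z3] := H Z ZW.
  by rewrite (subdivides_disjoint p_ccw sD YD WD ZY ZsW Z3).
- split; first by apply/orP; right; apply/bigcupP; exists Y.
  by have [H _ _] := fD Y YD; have [] := H Z ZY.
Qed.

(** S itself accounts for the factor t, and each other nonminimal member lies below exactly one
    piece. *)
Lemma card_nonminimal S D M : (2 < #|S|)%N -> subdivides p S D -> S \notin D ->
  nested S M -> M != [set S]%SET -> children M S = D ->
  t ^+ #|nonminimal M| = t * \prod_(Y in D) t ^+ #|nonminimal (below M Y)|.
Proof.
move=> S3 sD SD nM MS chD.
have [SM M_D MY] := (nested_split M S3 sD SD).1 (And3 nM MS chD).
rewrite prodrXr -exprS; congr (_ ^+ _).
have [Y0 YD0] := subdivides_neq0 S3 sD.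
have YM0 : Y0 \in M by have [_ + _] := MY Y0 YD0; rewrite inE => /andP[].
have Snm : S \in nonminimal M.
  rewrite inE SM; apply/exists_inP; exists Y0 => //.
  exact: subdivides_proper sD SD YD0.
rewrite (cardsD1 S) Snm add1n; congr _.+1.
pose F Y := if Y \in D then nonminimal (below M Y) else finset.set0.
have -> : nonminimal M :\ S = (\bigcup_Y F Y)%SET.
  apply/setP => X; rewrite in_setD1; apply/andP/bigcupP => [[XS Xnm]|[Y _]].
    have XM : X \in M by move: Xnm; rewrite inE => /andP[].
    have [XE|[Y YD XY]] := M_D X XM; first by rewrite XE eqxx in XS.
    by exists Y; rewrite // /F YD nonminimal_below inE Xnm.
  rewrite /F; case: ifP => YD; last by rewrite inE.
  rewrite nonminimal_below inE => /andP[Xnm XY]; split=> //.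
  apply: contraTneq XY => ->.
  by have := subdivides_proper sD SD YD; rewrite properE => /andP[].
rewrite -sum1_card partition_disjoint_bigcup /=; last first.
  move=> Y Z YZ; apply/pred0P => X /=; apply/negbTE/negP => /andP[].
  rewrite /F; case: ifP => YD; last by rewrite inE.
  case: ifP => ZD; last by move=> _; rewrite inE.
  rewrite !nonminimal_below !inE => /andP[/andP[XM _] XY] /andP[_ XZ].
  have [H _ _] := nM; have [_ X3] := H X XM.
  by rewrite (subdivides_disjoint p_ccw sD YD ZD XY XZ X3) eqxx in YZ.
rewrite [RHS]big_mkcond; apply: eq_bigr => Y _; rewrite /F sum1_card.
by case: ifP => // _; rewrite cards0.
Qed.

Lemma nested_sum_children S D : (2 < #|S|)%N -> subdivides p S D -> S \notin D ->
  \sum_(M : {set {set 'I_m}} |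
      [&& `[< nested S M >], M != [set S]%SET & children M S == D])
    t ^+ #|nonminimal M| = t * \prod_(Y in D) nested_sum Y.
Proof.
move=> S3 sD SD; rewrite /nested_sum.
(* The product of sums becomes a sum over functions choosing a Matryoshka of each piece. *)
rewrite (big_distr_big_dep finset.set0) /= mulr_sumr.
have split_M M : [&& `[< nested S M >], M != [set S]%SET & children M S == D] ->
    [/\ S \in M, forall Z, Z \in M -> Z = S \/ (exists2 Y, Y \in D & Z \subset Y)
    & forall Y, Y \in D -> nested Y (below M Y)].
  by move=> /and3P[/asboolP nM MS /eqP chD]; apply/(nested_split M S3 sD SD).
rewrite (reindex_onto (assemble S) (disassemble D)) /=; last first.
  move=> M /split_M[SM M_D MY]; apply/setP => Z; rewrite !inE.
  apply/orP/idP => [[/eqP -> //|/bigcupP[Y _]]|ZM].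
    by rewrite ffunE; case: ifP => _; rewrite inE // => /andP[].
  have [->|[Y YD ZY]] := M_D Z ZM; [by left|right].
  by apply/bigcupP; exists Y; rewrite // ffunE YD inE ZM.
apply: eq_big => [f|f /andP[/and3P[/asboolP nM MS /eqP chD] /eqP fE]]; last first.
  rewrite (card_nonminimal S3 sD SD nM MS chD); congr (_ * _).
  by apply: eq_bigr => Y YD; rewrite -{2}fE ffunE YD.
apply/andP/pfamilyP => [[/split_M[SM M_D MY] /eqP fE]|[f0 fD]].
  split=> [|Y YD]; first apply/fintype.subsetP => Y.
    rewrite unfold_in /= -fE ffunE; case: ifP => // _; by rewrite eqxx.
  by rewrite -fE ffunE YD; apply/asboolP; exact: MY.
have f0' Y : Y \notin D -> f Y = finset.set0.
  by move=> YD; apply/eqP; apply: contraNT YD => fY; apply: (fintype.subsetP f0).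
have fD' Y : Y \in D -> nested Y (f Y) by move=> /fD/asboolP.
have bE Y (YD : Y \in D) := below_assemble S3 sD SD f0' fD' YD.
split; last first.
  apply/eqP/ffunP => Y; rewrite ffunE; case: ifP => YD; first exact: bE.
  by rewrite f0' ?YD.
have [nM MS chD] : [/\ nested S (assemble S f), assemble S f != [set S]%SET
    & children (assemble S f) S = D].
  apply/(nested_split _ S3 sD SD); split=> [|Z|Y YD].
  - by rewrite !inE eqxx.
  - rewrite !inE => /orP[/eqP ->|/bigcupP[Y _ ZY]]; [by left|right].
    have YD : Y \in D by apply: contraLR ZY => /f0' ->; rewrite inE.
    by exists Y => //; have [H _ _] := fD' Y YD; have [] := H Z ZY.
  - by rewrite bE //; exact: fD'.
by apply/and3P; split; [exact/asboolP| |exact/eqP].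
Qed.

(** The summand 1 is the Matryoshka consisting of S alone; all others are grouped by the children of
    S. *)
Lemma nested_sumE S : (2 < #|S|)%N ->
  nested_sum S = 1 + t * \sum_(D : {set {set 'I_m}} |
    `[< subdivides p S D >] && (S \notin D)) \prod_(Y in D) nested_sum Y.
Proof.
move=> S3; have nm1 : nonminimal [set S]%SET = finset.set0.
  apply/setP => X; rewrite !inE; apply/negbTE/negP => /andP[/eqP -> /exists_inP[Y]].
  by rewrite inE => /eqP ->; rewrite fintype.properxx.
rewrite {1}/nested_sum (bigD1 [set S]%SET) /=; last first.
  apply/asboolP; split=> [Y||X]; rewrite ?nm1 ?inE // => /eqP -> //.
rewrite nm1 cards0 expr0; congr (_ + _).
rewrite (partition_big (fun M => children M S)
  (fun D => `[< subdivides p S D >] && (S \notin D))) /= => [|M /andP[/asboolP nM MS]].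
  rewrite mulr_sumr; apply: eq_bigr => D /andP[/asboolP sD SD].
  by rewrite -(nested_sum_children S3 sD SD); apply: eq_bigl => M; rewrite andbA.
apply/andP; split; last by rewrite !inE fintype.properxx andbF.
have [MSub SM sub] := nM; apply/asboolP; apply: sub; rewrite inE SM.
have [Y YM YS] : exists2 Y, Y \in M & Y != S.
  apply/exists_inP; apply: contraNT MS; rewrite negb_exists_in => /forall_inP H.
  apply/eqP/setP => Y; rewrite inE; apply/idP/eqP => [/H|-> //].
  by rewrite negbK => /eqP.
by apply/exists_inP; exists Y; rewrite // finset.properEneq YS (MSub Y YM).1.
Qed.

End Matryoshkas.

(** * Translation between sets of points and sets of labels *)

Section Bridge.
Variables (R : realType) (m : nat) (p : 'I_m -> 'rV[R]_2).
Hypotheses (p_convex : convex_position p) (p_ccw : ccw p).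
Local Open Scope classical_set_scope.
Implicit Types (S X Y Z : {set 'I_m}) (D M : {set {set 'I_m}}).

Definition hulls M : set (set 'rV[R]_2) := hull p @` [set` M].

Lemma mem_hulls M X : hulls M (hull p X) <-> X \in M.
Proof.
split=> [[Y /= YM /(hull_inj p_convex) <- //]|XM]; by exists X.
Qed.

Lemma hull_proper X Y : (hull p X `<` hull p Y) <-> X \proper Y.
Proof.
rewrite properE; split=> [[XY nYX]|/andP[XY nYX]].
  rewrite (hull_subset p_convex XY); apply/negP => YX; apply: nYX; exact: hullS.
split; first exact: hullS.
by move=> YX; rewrite (hull_subset p_convex YX) in nYX.
Qed.

Lemma polygonE : polygon p = hull p [set: 'I_m]%SET.
Proof.
rewrite /polygon /hull; congr convex_hull; apply/seteqP; split=> x [k _ <-].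
  by exists k => //=; rewrite finset.in_setT.
by exists k.
Qed.

Lemma not_min_hulls M : not_min (hulls M) = hulls (nonminimal M).
Proof.
apply/seteqP; split=> [_ [[X /= XM <-] nmin]|_ [X /= + <-]].
  exists X => //=; rewrite inE XM; apply: contrapT => H; apply: nmin.
  split=> [|_ [Y /= YM <-] /hull_proper YX]; first by exists X.
  by apply: H; apply/exists_inP; exists Y.
rewrite inE => /andP[XM /exists_inP[Y YM YX]]; split; first by exists X.
by move=> [_ /(_ (hull p Y))]; apply; [exists Y|exact/hull_proper].
Qed.

Lemma maximal_in_hulls M X :
  maximal_in [set A | hulls M A /\ A `<` hull p X] = hulls (children M X).
Proof.
apply/seteqP; split=> [_ [[[Y /= YM <-] /hull_proper YX] Ymax]|_ [Y /= + <-]].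
  exists Y => //=; rewrite inE YM YX; apply/forall_inP => Z ZM; apply/implyP => ZX.
  apply/negP => YZ; apply: (Ymax (hull p Z)); last exact/hull_proper.
  by split; [exists Z|exact/hull_proper].
rewrite inE => /and3P[YM YX /forall_inP Ymax]; split.
  by split; [exists Y|exact/hull_proper].
move=> _ [[Z /= ZM <-] /hull_proper ZX] /hull_proper YZ.
by have := Ymax Z ZM; rewrite ZX YZ.
Qed.

Lemma subdivision_hulls X D : (2 < #|X|)%N ->
  subdivision p (hull p X) (hulls D) <-> subdivides p X D.
Proof.
move=> X3; split=> [[sub cov dis]|[sub cov dis]].
  split=> [Y YD|_ x|Y Z YD ZD [x [Yx Zx]]].
  - split.
      apply: (hull_subset p_convex) => x Yx; rewrite -cov.
      by exists (hull p Y) => //; exists Y.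
    have [|S S3 /(hull_inj p_convex) ->//] := sub (hull p Y).
    by exists Y.
  - by rewrite -{1}cov => -[_ [Y /= YD <-] Yx]; exists Y.
  - apply: (hull_inj p_convex); apply: dis; [by exists Y|by exists Z|].
    by exists x.
split=> [_ [Y /= YD <-]||_ _ [Y /= YD <-] [Z /= ZD <-] [x [Yx Zx]]].
- by exists Y => //; have [] := sub Y YD.
- apply/seteqP; split=> [x [_ [Y /= YD <-] Yx]|x Xx].
    by have [YX _] := sub Y YD; exact: hullS YX _ Yx.
  by have [Y YD Yx] := cov X3 x Xx; exists (hull p Y) => //; exists Y.
- by congr hull; apply: dis => //; exists x.
Qed.

Lemma matryoshka_hulls M : matryoshka p (hulls M) <-> nested p [set: 'I_m]%SET M.
Proof.
split=> [[sub PM nm]|[sub PM nm]].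
  have M3 Y : Y \in M -> (2 < #|Y|)%N.
    move=> YM; have [|S S3 /(hull_inj p_convex) ->//] := sub (hull p Y).
    by exists Y.
  split=> [Y YM||X Xnm].
  - by split; [exact: finset.subsetT|exact: M3].
  - by apply/mem_hulls; rewrite -polygonE.
  - have XM : X \in M by move: Xnm; rewrite inE => /andP[].
    apply/subdivision_hulls; first exact: M3.
    by rewrite -maximal_in_hulls; apply: nm; rewrite not_min_hulls; exists X.
split=> [_ [Y /= YM <-]||A].
- by exists Y => //; have [] := sub Y YM.
- by rewrite polygonE; apply/mem_hulls.
- rewrite not_min_hulls => -[X /= Xnm <-]; rewrite maximal_in_hulls.
  have XM : X \in M by move: Xnm; rewrite inE => /andP[].
  by apply/subdivision_hulls; [have [] := sub X XM|exact: nm].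
Qed.

Lemma card_hulls M : #|` fset_set (hulls M)| = #|M|.
Proof.
rewrite cardE -(size_map (hull p)); apply/perm_size/uniq_perm.
- exact: fset_uniq.
- by rewrite map_inj_uniq ?enum_uniq //; exact: hull_inj.
move=> A; have -> : (A \in (fset_set (hulls M) : seq _)) = (A \in fset_set (hulls M)) by [].
rewrite in_fset_set; last by apply: finite_image; exact: finite_finset.
apply/idP/mapP => [|[X + ->]].
  by rewrite inE => -[X /= XM <-]; exists X; rewrite // mem_enum.
by rewrite mem_enum inE => XM; exists X.
Qed.

Lemma matryoshka_poly_nested :
  matryoshka_poly p = nested_sum p ('X : {poly R}) [set: 'I_m]%SET.
Proof.
rewrite /matryoshka_poly /nested_sum.
rewrite (reindex_fsbig hulls [set M | nested p [set: 'I_m]%SET M]) /=.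
  transitivity (\sum_(M \in [set M | nested p [set: 'I_m]%SET M])
      ('X : {poly R}) ^+ #|nonminimal M|).
    by apply: eq_fsbigr => M _; rewrite not_min_hulls card_hulls.
  rewrite -big_enum [RHS]fsbig_seq ?enum_uniq //; apply: eq_fsbigl.
  by apply/seteqP; split=> M /=; rewrite mem_enum unfold_in => /asboolP.
split.
- by move=> M /= nM; apply/matryoshka_hulls.
- move=> M N _ _ MN; apply/setP => X.
  by apply/idP/idP => /mem_hulls; [rewrite MN|rewrite -MN] => /mem_hulls.
(* Surjectivity: every member of a Matryoshka is a subpolygon, hence the hull of some label set, so
   [N] is recovered from the labels of its members. *)
move=> N mN; pose M := [set S | `[< N (hull p S) >]]%SET.
have NE : N = hulls M.
  apply/seteqP; split=> [A NA|_ [X /= + <-]]; last by rewrite inE => /asboolP.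
  have [sub _ _] := mN; have [S S3 AE] := sub A NA.
  by exists S; rewrite //= inE; apply/asboolP; rewrite /hull -AE.
by exists M => //=; apply/matryoshka_hulls; rewrite -NE.
Qed.

End Bridge.

(** * Invariance under relabelling of the vertices *)

Section Relabelling.
Variables (R : realType) (m : nat) (p : 'I_m -> 'rV[R]_2) (s : {perm 'I_m}).
Local Open Scope classical_set_scope.

Lemma convex_position_perm : convex_position p -> convex_position (p \o s).
Proof.
move=> cp i H; apply: (cp (s i)); apply: convex_hullS H => _ [j /= ji <-].
by exists (s j) => //=; rewrite (inj_eq perm_inj).
Qed.

Lemma polygon_perm : polygon (p \o s) = polygon p.
Proof.
rewrite /polygon; congr convex_hull; apply/seteqP; split=> _ [k _ <-].
  by exists (s k).
by exists (s^-1%g k) => //=; rewrite permKV.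
Qed.

Lemma subpolygon_perm : subpolygon (p \o s) = subpolygon p.
Proof.
apply/seteqP; split=> A [S S3 ->].
  exists (s @: S)%SET; first by rewrite card_imset //; exact: perm_inj.
  congr convex_hull; apply/seteqP; split=> [_ [k /= kS <-]|_ [k /= /imsetP[j jS ->] <-]].
    by exists (s k) => //=; apply: imset_f.
  by exists j.
exists (s^-1%g @: S)%SET; first by rewrite card_imset //; exact: perm_inj.
congr convex_hull; apply/seteqP; split=> [_ [k /= kS <-]|_ [k /= /imsetP[j jS ->] <-]].
  by exists (s^-1%g k) => /=; rewrite ?permKV //; apply: imset_f.
by exists j => //=; rewrite permKV.
Qed.

Lemma matryoshka_perm : matryoshka (p \o s) = matryoshka p.
Proof. by rewrite /matryoshka /subdivision polygon_perm subpolygon_perm. Qed.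

Lemma matryoshka_poly_perm : matryoshka_poly (p \o s) = matryoshka_poly p.
Proof. by rewrite /matryoshka_poly matryoshka_perm. Qed.

End Relabelling.

(** * Independence of the chosen polygon, and the conclusion *)

Section PolygonIndependence.
Variables (R : realType) (K : comNzRingType) (t : K).

(** The trivial subdivision contributes [w #|S|] to the full subdivision sum and is subtracted
    again. As [nested_sum] is compared with [w] only on smaller sets, [w #|S|] may be any value. *)
Lemma nested_sum_coef m (p : 'I_m -> 'rV[R]_2) (w beta : nat -> K) (S : {set 'I_m}) :
  ccw p -> beta 0%N = 0 -> beta 1%N = 1 ->
  (forall n, beta n.+2 = \sum_(k < n.+1) w k.+3 * fps_exp beta k.+2 n.+2) ->
  (2 < #|S|)%N ->
  (forall Y : {set 'I_m}, (2 < #|Y|)%N -> (#|Y| < #|S|)%N -> nested_sum p t Y = w #|Y|) ->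
  nested_sum p t S = 1 + t * (beta #|S|.-1 - w #|S|).
Proof.
move=> pc b0 b1 bE S3 wE; rewrite nested_sumE //; congr (_ + t * _).
rewrite -(subdivision_sumE pc b0 b1 bE (ltnW S3)) /subdivision_sum.
rewrite [in RHS](bigD1 [set S]%SET) /=; last exact/asboolP/subdivides1.
rewrite big_set1 [X in _ = X - _]addrC addrK; apply: eq_big => D; last first.
  move=> /andP[/asboolP sD SD]; apply: eq_bigr => Y YD; have [DS _ _] := sD.
  apply: wE; first by have [] := DS Y YD.
  by apply: proper_card; exact: subdivides_proper sD SD YD.
case: asboolP => //= sD; apply/idP/idP => [|DS].
  by apply: contraNneq => ->; rewrite inE.
apply: contraNN DS => SD; apply/eqP/setP => Y; rewrite inE.
have [DS _ _] := sD.
apply/idP/eqP => [YD|-> //]; have [YS Y3] := DS Y YD.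
exact: (subdivides_disjoint pc sD YD SD (fintype.subxx Y) YS Y3).
Qed.

End PolygonIndependence.

Theorem theorem5p4 (R : realType) (P : forall n : nat, 'I_n.+2 -> 'rV[R]_2)
    (hP : forall n : nat, (0 < n)%N -> convex_position (P n)) :
  let f : nat -> {poly R} := fun n => matryoshka_poly (P n) in
  [/\ f 1%N = 1, f 2%N = 1 + 2 * 'X & f 3%N = 1 + 10 * 'X + 10 * 'X^2] /\
  (forall n : nat, (0 < n)%N -> exists q : {poly R}, gcoef f n = to_ratfun q) /\
  inverse_pair f /\
  (forall h : nat -> {poly R}, inverse_pair h ->
     forall n : nat, (0 < n)%N -> h n = f n) /\
  functional_equation f /\
  (forall h : nat -> {poly R}, inverse_pair h <-> functional_equation h).
Proof.
move=> f.
have canon n : exists p : 'I_n.+3 -> 'rV[R]_2, ccw p /\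
    f n.+1 = nested_sum p 'X [set: 'I_n.+3]%SET.
  have cP := hP n.+1 isT; have [s sc] := convex_position_ccw cP.
  exists (P n.+1 \o s); split=> //.
  rewrite -matryoshka_poly_nested //; last exact: convex_position_perm.
  by rewrite matryoshka_poly_perm.
(* A piece with n+2 vertices, in whatever polygon it sits, has the sum f_n; hence the shift by 2. *)
have fE m (p : 'I_m -> 'rV[R]_2) (S : {set 'I_m}) : ccw p -> (2 < #|S|)%N ->
    nested_sum p 'X S = f (#|S| - 2)%N.
  move cS: #|S| => N; elim/ltn_ind: N m p S cS => N IH m p S cS pc N3.
  (* Only weights below [N] are known at this stage. With the value 0 at [N], the right-hand side of
     [key] depends on [N] alone, so [S] and the whole polygon from [canon] get the same sum. *)
  pose w k := if (k < N)%N then f (k - 2)%N else 0.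
  have [b [b0 b1 bE]] := exists_inverse_coefs w.
  have key m' (p' : 'I_m' -> 'rV[R]_2) (S' : {set 'I_m'}) : ccw p' -> #|S'| = N ->
      nested_sum p' 'X S' = 1 + 'X * b N.-1.
    move=> pc' cS'; rewrite (nested_sum_coef pc' b0 b1 bE) cS' //.
      by rewrite [w N]/w ltnn subr0.
    by move=> Y Y3 YN; rewrite (IH #|Y| YN) // /w YN.
  rewrite (key _ _ _ pc cS); case: N N3 {IH cS w bE} key => [|[|[|N]]] // _ key.
  have [p' [pc' ->]] := canon N.
  by rewrite key // cardsT card_ord.
have [b [b0 b1 bE]] := exists_inverse_coefs (fun k => f (k - 2)%N).
have bE' n : b n.+2 = \sum_(k < n.+1) f k.+1 * fps_exp b k.+2 n.+2.
  by rewrite bE; apply: eq_bigr => k _; rewrite subn2.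
have fb n : (1 + 'X) * f n.+1 = 1 + 'X * b n.+2.
  have [p [pc fp]] := canon n.
  have cT : #|[set: 'I_n.+3]%SET| = n.+3 by rewrite cardsT card_ord.
  (* This time the weight at the top is the true f, so the recursion reads f = 1 + t (b - f), which
     is the identity sought. *)
  have := @nested_sum_coef R _ 'X _ p (fun k => f (k - 2)%N) b [set: 'I_n.+3]%SET
    pc b0 b1 bE.
  rewrite cT subn2 -fp /= => /(_ isT) H.
  have e : f n.+1 = 1 + 'X * (b n.+2 - f n.+1).
    by apply: H => Y Y3 _; exact: fE.
  by apply: (eq_from_multiple (k := 1) e); ring.
have [gE invf] := inverse_pair_coefs b0 b1 bE' fb.
split; first exact: inverse_pair_values b0 b1 bE' fb.
split; first by case=> // n _; exists (b n.+2); exact: gE.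
split=> //; split; first by move=> h invh; exact: inverse_pair_uniq.
by split; [exact/functional_equationP|exact: functional_equationP].
Qed.
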